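(* For every $\delta_0\in(-a,b)$, if the network is generated with true parameter $\delta_0$, then the maximum likelihood estimator satisfies $\hat\delta_n\to\delta_0$ in probability as $n\to\infty$.
   Context: Initial degrees. $(m_t)_{t\ge1}$ is an i.i.d. sequence of positive-integer-valued random variables with mean $\mu=\mathbb{E}m_1\ge 1$ and finite second moment. $M_t=\sum_{j=1}^t m_j$. Model (affine preferential attachment with random initial degrees, parameter $\delta>-1$). $\mathrm{PA}_1(\delta)$ has two vertices $v_0,v_1$ joined by $m_1$ edges. For $t\ge2$, given $\mathrm{PA}_{t-1}(\delta)=:\mathrm{PA}_{t,0}(\delta)$ with vertex set $V_{t-1}=\{v_0,\dots,v_{t-1}\}$, a new vertex $v_t$ is added, and sequentially for $i=1,\dots,m_t$ the network $\mathrm{PA}_{t,i}(\delta)$ is obtained from $\mathrm{PA}_{t,i-1}(\delta)$ by adding an edge between $v_t$ and a random vertex of $V_{t-1}$, where (conditionally on the past and on $(m_t)_{t\ge1}$) vertex $v_j\in V_{t-1}$ is chosen with probability $(\mathrm{Deg}_{t,i-1}(v_j)+\delta)/S_{t,i-1}(\delta)$. Here $\mathrm{Deg}_{t,i-1}(v)$ is the degree of $v$ in $\mathrm{PA}_{t,i-1}(\delta)$ and $S_{t,i-1}(\delta)=\sum_{v\in V_{t-1}}(\mathrm{Deg}_{t,i-1}(v)+\delta)=t\delta+2M_{t-1}+(i-1)$. Finally $\mathrm{PA}_t(\delta)=\mathrm{PA}_{t,m_t}(\delta)$. Statistics and MLE. $N_k(n)$ is the number of vertices of degree $k$ in the network at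 time $n$, $N_{>k}(n)=\sum_{j>k}N_j(n)$, and $R_{>k}(n)=2\cdot 1_{\{m_1>k\}}+\sum_{t=2}^n1_{\{m_t>k\}}$. For $\delta>-1$, the normalized log-likelihood (up to a term not depending on $\delta$) is $$\iota_n(\delta)=\sum_{k=1}^\infty\log(k+\delta)\frac{N_{>k}(n)-R_{>k}(n)}{n+1}-\frac1{n+1}\sum_{t=2}^n\sum_{i=1}^{m_t}\log S_{t,i-1}(\delta).$$ The parameter set is $[-a,b]$ with given numbers $-1<-a<b<\infty$, and the MLE is $\hat\delta_n=\arg\max_{\delta\in[-a,b]}\iota_n(\delta)$. *)

(* Defs.v *)
From HB Require Import structures.
From mathcomp Require Import all_boot all_order all_algebra.
From mathcomp Require Import all_classical all_reals all_analysis.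

Set Implicit Arguments.
Unset Strict Implicit.
Unset Printing Implicit Defensive.

Import Order.TTheory GRing.Theory Num.Theory.
Import numFieldNormedType.Exports.

Local Open Scope classical_set_scope.
Local Open Scope ring_scope.

(** The vertex v_j is encoded by the natural number j.  A network is encoded by
    the list of its edges in order of appearance; its vertex set is known from
    the time t, namely {0, ..., t}.  Multiple edges are allowed. *)
Definition network := seq (nat * nat).

Definition degree (g : network) (v : nat) : nat :=
  (count (fun e => e.1 == v) g + count (fun e => e.2 == v) g)%N.

(** Throughout, a realization of the construction is given by [m], where [m t]
    (t >= 1) is the initial degree of v_t, and by [c], where [c t i]
    (t >= 2, 1 <= i <= m t) is the older endpoint of the i-th edge of v_t.
    The other values of [m] and [c] are never used. *)
Definition new_edges (c : nat -> nat -> nat) (t i : nat) : network :=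
  [seq (t, c t l) | l <- iota 1 i].

Fixpoint PA (m : nat -> nat) (c : nat -> nat -> nat) (t : nat) : network :=
  match t with
  | 0 => [::]
  | t'.+1 => if t' == 0%N then nseq (m 1%N) (1%N, 0%N)
             else PA m c t' ++ new_edges c t'.+1 (m t'.+1)
  end.

(** The intermediate network PA_{t,i}, for t >= 2 and 0 <= i <= m t. *)
Definition PA_step (m : nat -> nat) (c : nat -> nat -> nat) (t i : nat)
  : network := PA m c t.-1 ++ new_edges c t i.

Section likelihood.
Context {R : realType}.
Implicit Types (m : nat -> nat) (c : nat -> nat -> nat) (delta : R).

(** S_{t,i}(delta); the sum is over the vertices v_0, ..., v_{t-1}. *)
Definition total_weight m c (t i : nat) delta : R :=
  \sum_(v < t) ((degree (PA_step m c t i) v)%:R + delta).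

Definition attach_prob m c (t i j : nat) delta : R :=
  ((degree (PA_step m c t i) j)%:R + delta) / total_weight m c t i delta.

Definition N_eq m c (k n : nat) : nat :=
  #|[set v : 'I_n.+1 | degree (PA m c n) v == k]%SET|.

Definition N_gt m c (k n : nat) : R :=
  limn (fun K => \sum_(k.+1 <= j < K) (N_eq m c j n)%:R : R).

Definition R_gt m (k n : nat) : R :=
  2 * (k < m 1%N)%:R + \sum_(2 <= t < n.+1) (k < m t)%:R.

(** The normalized log-likelihood, up to a term not depending on delta.  Its
    first sum over k, as the sum in [N_gt], has finitely many nonzero terms. *)
Definition iota_n m c (n : nat) delta : R :=
  limn (fun K => \sum_(1 <= k < K)
    ln (k%:R + delta) * ((N_gt m c k n - R_gt m k n) / n.+1%:R) : R)
  - n.+1%:R^-1 * \sum_(2 <= t < n.+1) \sum_(1 <= i < (m t).+1)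
                    ln (total_weight m c t i.-1 delta).

Definition is_argmax (D : set R) (f : R -> R) (x : R) : Prop :=
  D x /\ forall y, D y -> f y <= f x.

End likelihood.

Section model.
Context {d : measure_display} {Omega : measurableType d} {R : realType}.
Variable P : probability Omega R.

Definition iid_initial_degrees (m : nat -> {RV P >-> nat}) : Prop :=
  [/\ forall t w, (0 < t)%N -> (0 < m t w)%N,
      forall (t : nat) (A : set nat), (0 < t)%N ->
        P (m t @^-1` A) = P (m 1%N @^-1` A),
      forall (s : seq nat) (A : nat -> set nat),
        uniq s -> all (fun t => 0 < t)%N s ->
        P (\bigcap_(t in [set` s]) (m t @^-1` A t)) =
        (\prod_(t <- s) P (m t @^-1` A t))%E
    & ('E_P[(fun w => (m 1%N w)%:R ^+ 2 : R)%R] < +oo)%E].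

Variables (m : nat -> {RV P >-> nat}) (c : nat -> nat -> {RV P >-> nat}).

Definition m_at (w : Omega) : nat -> nat := fun t => m t w.
Definition c_at (w : Omega) : nat -> nat -> nat := fun t i => c t i w.

(** The sigma-algebra generated by the whole sequence (m_s)_{s >= 1} and by the
    network PA_{t,i}; since the edges of PA_{t,i} are listed in order of
    appearance, the latter carries the whole history of the construction. *)
Definition past (t i : nat) : set (set Omega) :=
  <<s [set B | (exists s k, (0 < s)%N /\ B = [set w | m s w = k]) \/
               (exists g, B = [set w | PA_step (m_at w) (c_at w) t i = g])] >>.

(** The i-th edge of v_t exists only on the event {i <= m_t}, which belongs to
    the past.  The second clause says that on this event the conditional
    probability of {c_{t,i} = j} given the past is [attach_prob], which is
    measurable with respect to the past, being a function of PA_{t,i-1}. *)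
Definition is_PA (delta : R) : Prop :=
  iid_initial_degrees m /\
  forall t i, (2 <= t)%N -> (1 <= i)%N ->
    (forall w, (i <= m t w)%N -> (c t i w < t)%N) /\
    (forall (j : nat) (A : set Omega), (j < t)%N ->
       past t i.-1 A -> A `<=` [set w | (i <= m t w)%N] ->
       P (A `&` [set w | c t i w = j]) =
       (\int[P]_(w in A) (attach_prob (m_at w) (c_at w) t i.-1 j delta)%:E)%E).

(** Any maximizer is allowed as the value of the arg max. *)
Definition is_MLE (a b : R) (n : nat) (delta_hat : Omega -> R) : Prop :=
  forall w, is_argmax `[- a, b] (iota_n (m_at w) (c_at w) n) (delta_hat w).

Definition cvg_in_probability (X : nat -> {RV P >-> R}) (x : R) : Prop :=
  forall eps : R, 0 < eps ->
    P [set w | eps <= `|X n w - x|] @[n --> \oo] --> 0%E.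

End model.

(* Main.v *)
Require Import Defs.
From HB Require Import structures.
From mathcomp Require Import all_boot all_order all_algebra.
From mathcomp Require Import all_classical all_reals all_analysis.
From mathcomp Require Import measurable_realfun.
From mathcomp Require Import zify ring lra.

Set Implicit Arguments.
Unset Strict Implicit.
Unset Printing Implicit Defensive.

Import Order.TTheory GRing.Theory Num.Theory.
Import numFieldNormedType.Exports.

Local Open Scope classical_set_scope.
Local Open Scope ring_scope.

(** Up to the factor n + 1, the likelihood is the sum over all edges of the
    logarithm of the conditional probability of the vertex they were attached
    to.  Hence (n + 1) (iota_n(delta) - iota_n(delta0)) is a martingale, whose
    variance is O(n) because the log-ratios are bounded, minus the sum of the
    Kullback-Leibler divergences between the attachment laws for delta0 and
    delta.

    Let r be the least value of m_1 with positive probability.  Almost surely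
    the average degree stays above r + 1/3 from the third vertex on, so that
    for a vertex of degree at most r the two laws differ by a factor bounded
    away from 1; therefore the divergence is at least a constant times the
    conditional probability of hitting such a vertex.  These hitting
    probabilities add up to at least a multiple of n: of the vertices of
    initial degree at most r, of which there are about n P(m_1 <= r), either a
    positive fraction has been hit, or a positive fraction still has degree at
    most r at time n and was then present during the last steps.

    Since iota_n is Lipschitz in delta with constant O(M_n / n), comparing with
    iota_n(delta0) on a finite grid is enough. *)

(** * Degrees along the construction *)

Lemma PA_1 m c : PA m c 1 = nseq (m 1%N) (1%N, 0%N).
Proof. by []. Qed.

Lemma PA_succ m c t : (2 <= t)%N -> PA m c t = PA_step m c t (m t).
Proof. by case: t => [|[|t]]. Qed.

Lemma PA_step0 m c t : PA_step m c t 0 = PA m c t.-1.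
Proof. by rewrite /PA_step /new_edges /= cats0. Qed.

Lemma new_edgesS c t i :
  new_edges c t i.+1 = rcons (new_edges c t i) (t, c t i.+1).
Proof.
by rewrite /new_edges -[in iota _ _](addn1 i) iotaD map_cat /= add1n cats1.
Qed.

Lemma PA_stepS m c t i :
  PA_step m c t i.+1 = rcons (PA_step m c t i) (t, c t i.+1).
Proof. by rewrite /PA_step new_edgesS rcons_cat. Qed.

Lemma degree_rcons g e v :
  degree (rcons g e) v = (degree g v + (e.1 == v) + (e.2 == v))%N.
Proof. by rewrite /degree -!cats1 !count_cat /=; lia. Qed.

Lemma degree_nseq k v :
  degree (nseq k (1%N, 0%N)) v = (k * ((v == 1%N) + (v == 0%N)))%N.
Proof. by rewrite /degree !count_nseq /= !(eq_sym v); lia. Qed.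

Section realization.
Variables (m : nat -> nat) (c : nat -> nat -> nat).
Hypothesis m_gt0 : forall t, (0 < t)%N -> (0 < m t)%N.
Hypothesis c_lt : forall t i, (2 <= t)%N -> (i < m t)%N -> (c t i.+1 < t)%N.

(* Edges are counted from 0 here, while [c t] is indexed from 1. *)
Definition chosen_degree (t i : nat) : nat :=
  degree (PA_step m c t i) (c t i.+1).
Local Notation D := chosen_degree.

Lemma degree_fresh t v : (t < v)%N -> degree (PA m c t) v = 0%N.
Proof.
elim: t v => [|t IH] v tv //.
case: t IH tv => [|t] IH tv.
  by rewrite PA_1 degree_nseq; case: v tv => [|[|v]] //= _; rewrite muln0.
rewrite PA_succ //.
have H i : (i <= m t.+2)%N -> degree (PA_step m c t.+2 i) v = 0%N.
  elim: i => [|i IHi] im; first by rewrite PA_step0 IH // ltnW.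
  rewrite PA_stepS degree_rcons IHi ?(ltnW im) //=.
  by have := @c_lt t.+2 i isT im; lia.
exact: H.
Qed.

Lemma degree_new t i : (2 <= t)%N -> (i <= m t)%N ->
  degree (PA_step m c t i) t = i.
Proof.
move=> t2; elim: i => [|i IH] im.
  by rewrite PA_step0 degree_fresh // prednK // ltnW.
rewrite PA_stepS degree_rcons IH ?(ltnW im) //= eqxx.
by have := c_lt t2 im; lia.
Qed.

Lemma leq_degree_step t i v : (2 <= t)%N ->
  (degree (PA m c t.-1) v <= degree (PA_step m c t i) v)%N.
Proof.
move=> t2; elim: i => [|i IH]; first by rewrite PA_step0.
by rewrite PA_stepS degree_rcons; lia.
Qed.

Lemma degree_gt0 t v : (0 < t)%N -> (v <= t)%N -> (0 < degree (PA m c t) v)%N.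
Proof.
elim: t v => [|t IH] v // _ vt.
case: t IH vt => [|t] IH vt.
  by rewrite PA_1 degree_nseq; have := @m_gt0 1%N isT; case: v vt => [|[|]] //=; lia.
rewrite PA_succ //; move: vt; rewrite leq_eqVlt => /predU1P[->|vt].
  by rewrite degree_new // m_gt0.
by rewrite (leq_trans _ (leq_degree_step _ _ _)) // IH.
Qed.

Lemma degree_step_gt0 t i v : (2 <= t)%N -> (v < t)%N ->
  (0 < degree (PA_step m c t i) v)%N.
Proof.
move=> t2 vt; rewrite (leq_trans _ (leq_degree_step _ _ _)) // degree_gt0; lia.
Qed.

Section degree_sum.
Context {V : zmodType}.
Variable phi : nat -> V.

(** Each edge of v_t raises the degree of exactly one older vertex by one, so the sum telescopes
    along the edges. Values in an additive group are allowed because increments of [phi] may be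
    negative. *)
Lemma sum_degree_step t i : (2 <= t)%N -> (i <= m t)%N ->
  \sum_(v < t) phi (degree (PA_step m c t i) v) =
  \sum_(v < t) phi (degree (PA m c t.-1) v) +
  \sum_(0 <= l < i) (phi (D t l).+1 - phi (D t l)).
Proof.
move=> t2; elim: i => [|i IH] im.
  by rewrite big_geq // addr0 PA_step0.
rewrite big_nat_recr //= addrA -IH ?(ltnW im) //.
have ct := c_lt t2 im.
rewrite (bigD1 (Ordinal ct)) //= [in RHS](bigD1 (Ordinal ct)) //=.
rewrite PA_stepS degree_rcons /= eqxx (gtn_eqF ct) addn0 addn1 -/(D t i).
rewrite addrC [in RHS]addrAC addrCA subrr addr0 addrC; congr (_ + _).
apply: eq_bigr => v /eqP vc; rewrite degree_rcons /=.
congr phi; have /eqP := ltn_ord v.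
have : (nat_of_ord v != c t i.+1) by apply/eqP => E; apply: vc; exact/val_inj.
by have := ltn_ord v; lia.
Qed.

(** The bookkeeping identity behind all degree counts: [phi] will be the cast to integers, the
    indicator of degrees above k, or that of degrees at most r. The term [phi (m 1)] occurs twice
    because v_0 and v_1 both start with degree m_1. *)
Lemma sum_degree n : (0 < n)%N ->
  \sum_(v < n.+1) phi (degree (PA m c n) v) =
  phi (m 1%N) + \sum_(1 <= t < n.+1) phi (m t) +
  \sum_(2 <= t < n.+1) \sum_(0 <= i < m t) (phi (D t i).+1 - phi (D t i)).
Proof.
case: n => // n _; elim: n => [|n IH].
  rewrite big_nat1 [X in _ + X]big_geq // addr0 !big_ord_recl big_ord0 addr0 /=.
  by rewrite !degree_nseq /= !addn0 !muln1.
rewrite big_ord_recr /= -/(PA m c n.+1) [X in X + _](_ : _ =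
    \sum_(v < n.+2) phi (degree (PA_step m c n.+2 (m n.+2)) v)); last first.
  by apply: eq_bigr => v _; rewrite -PA_succ.
rewrite (_ : PA m c n.+1 ++ _ = PA_step m c n.+2 (m n.+2)) // degree_new //.
rewrite sum_degree_step // IH (@big_nat_recr _ _ _ n.+2 1) //=.
rewrite (@big_nat_recr _ _ _ n.+2 2) //= -!addrA; congr (_ + (_ + _)).
by rewrite addrA addrC.
Qed.

End degree_sum.

Lemma degree_total t i : (2 <= t)%N -> (i <= m t)%N ->
  (\sum_(v < t) degree (PA_step m c t i) v =
   2 * \sum_(1 <= s < t) m s + i)%N.
Proof.
move=> t2 im; have := sum_degree_step Posz t2 im.
have -> : \sum_(0 <= l < i) (Posz (D t l).+1 - Posz (D t l)) = Posz i.
  rewrite (eq_bigr (fun=> 1)) => [|l _]; last by rewrite -addn1 PoszD; lia.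
  by rewrite big_const_nat subn0 iter_addr addr0 natz.
case: t t2 im => // t t2 im /=; rewrite (@sum_degree _ Posz t) //.
have -> : \sum_(2 <= s < t.+1) \sum_(0 <= l < m s)
    (Posz (D s l).+1 - Posz (D s l)) = \sum_(2 <= s < t.+1) Posz (m s).
  apply: eq_bigr => s _.
  rewrite (eq_bigr (fun=> 1)) => [|l _]; last by rewrite -addn1 PoszD; lia.
  by rewrite big_const_nat subn0 iter_addr addr0 natz.
rewrite -!(big_morph Posz PoszD (erefl _)) (big_ltn t2).
rewrite -!PoszD; lia.
Qed.

End realization.

(** * The likelihood as a sum over the edges *)

Section realization_likelihood.
Context {R : realType}.
Variables (m : nat -> nat) (c : nat -> nat -> nat).
Hypothesis m_gt0 : forall t, (0 < t)%N -> (0 < m t)%N.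
Hypothesis c_lt : forall t i, (2 <= t)%N -> (i < m t)%N -> (c t i.+1 < t)%N.
Local Notation D := (chosen_degree m c).

Lemma lim_eventually_cst (u : nat -> R) (x : R) N :
  (forall n, (N <= n)%N -> u n = x) -> limn u = x.
Proof.
move=> uE; apply/cvg_lim => //; apply: cvg_near_cst.
by exists N => // n /= Nn; rewrite uE.
Qed.

Lemma sum_nat_delta (F : nat -> R) a b k : (a <= k < b)%N ->
  \sum_(a <= j < b) F j * (k == j)%:R = F k.
Proof.
move=> akb; rewrite (bigD1_seq k) ?mem_index_iota ?iota_uniq //= eqxx mulr1.
by rewrite big1 ?addr0 // => j /negPf jk; rewrite eq_sym jk mulr0.
Qed.

Lemma N_gtE k n :
  N_gt m c k n = \sum_(v < n.+1) (k < degree (PA m c n) v)%:R :> R.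
Proof.
(* A [K] beyond the total degree exceeds every single degree, so the truncated sum already equals
   its limit. *)
apply: (@lim_eventually_cst _ _ (\sum_(v < n.+1) degree (PA m c n) v).+1) => K MK.
under eq_bigr do rewrite /N_eq -sum1_card natr_sum.
under eq_bigr => j _ do
  (rewrite big_mkcond /=; under eq_bigr => v _ do rewrite inE).
rewrite exchange_big; apply: eq_bigr => v _ /=.
have dK : (degree (PA m c n) v < K)%N.
  by apply: leq_trans MK; rewrite ltnS (bigD1 v) //= leq_addr.
case: ltnP => kd.
  rewrite -[RHS](@sum_nat_delta (fun=> 1) k.+1 K (degree (PA m c n) v)) ?kd //.
  by apply: eq_bigr => j _; rewrite mul1r; case: eqP.
by rewrite big_nat big1 // => j /andP[dj jd]; rewrite ltn_eqF //; lia.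
Qed.

(** A vertex gets a degree above k either at birth, which [R_gt] counts, or when an edge hits it at
    degree exactly k. *)
Lemma N_gt_R_gt k n : (0 < n)%N -> N_gt m c k n =
  R_gt m k n + \sum_(2 <= t < n.+1) \sum_(0 <= i < m t) (D t i == k)%:R :> R.
Proof.
move=> n0; rewrite N_gtE (sum_degree c_lt (fun d => (k < d)%:R)) //.
rewrite /R_gt big_ltn ?ltnS // mulr_natl mulr2n -!addrA; congr (_ + (_ + (_ + _))).
apply: eq_bigr => t _; apply: eq_bigr => i _.
by rewrite ltnS leq_eqVlt eq_sym; case: ltngtP => ? /=; rewrite ?subrr ?subr0.
Qed.

Lemma total_weight_gt0 t i (delta : R) : (2 <= t)%N -> -1 < delta ->
  0 < total_weight m c t i delta.
Proof.
move=> t2 d1; rewrite /total_weight (bigD1 (Ordinal (ltnW t2))) //=.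
have H v : (v < t)%N -> 0 < (degree (PA_step m c t i) v)%:R + delta.
  by move=> /(degree_step_gt0 m_gt0 c_lt i t2); rewrite -(@ler_nat R) => ?; lra.
by rewrite ltr_pwDl ?H ?(ltnW t2)// sumr_ge0 // => v _; rewrite ltW ?H.
Qed.

Definition loglik n (delta : R) : R :=
  \sum_(2 <= t < n.+1) \sum_(0 <= i < m t)
    ln (attach_prob m c t i (c t i.+1) delta).

(** After exchanging the sums, each edge contributes ln(D + delta), with D the degree of the vertex
    it hits, minus the logarithm of the total weight. *)
Lemma iota_nE n (delta : R) : (0 < n)%N -> -1 < delta ->
  iota_n m c n delta = n.+1%:R^-1 * loglik n delta.
Proof.
move=> n0 d1; rewrite /iota_n (@lim_eventually_cst _ (n.+1%:R^-1 *
   \sum_(2 <= t < n.+1) \sum_(0 <= i < m t) ln ((D t i)%:R + delta))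
   (\sum_(2 <= t < n.+1) \sum_(0 <= i < m t) D t i).+1); last first.
  move=> K MK; under eq_bigr => k _ do
    rewrite N_gt_R_gt // addrAC subrr add0r mulrA mulr_sumr.
  rewrite -mulr_suml mulrC; congr (_ * _).
  under eq_bigr => k _ do (under eq_bigr => t _ do rewrite mulr_sumr).
  rewrite exchange_big /= !big_nat; apply: eq_bigr => t /andP[t2 tn].
  rewrite exchange_big /= !big_nat; apply: eq_bigr => i /andP[_ im].
  have DK : (D t i < K)%N.
    apply: leq_trans MK; rewrite ltnS (@big_cat_nat _ _ _ t 2) ?t2 ?(ltnW tn) //=.
    rewrite (big_ltn tn) (@big_cat_nat _ _ _ i 0) ?(ltnW im) //=.
    rewrite (big_ltn im) (leq_trans _ (leq_addl _ _)) //.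
    rewrite (leq_trans _ (leq_addr _ _)) // (leq_trans _ (leq_addl _ _)) //.
    exact: leq_addr.
  have D0 : (0 < D t i)%N by apply: (degree_step_gt0 m_gt0 c_lt) => //; exact: c_lt.
  by rewrite sum_nat_delta ?D0.
rewrite -mulrBr -sumrB /loglik; congr (_ * _); rewrite !big_nat.
apply: eq_bigr => t /andP[t2 tn].
rewrite big_add1 /= -sumrB !big_nat; apply: eq_bigr => i /andP[_ im].
rewrite /attach_prob ln_div ?posrE ?total_weight_gt0 // -/(D t i).
have := degree_step_gt0 m_gt0 c_lt i t2 (c_lt t2 im).
by rewrite -/(D t i) -(@ler_nat R) => ?; lra.
Qed.

End realization_likelihood.

(** * Divergence between two attachment laws *)

Section attachment_divergence.
Context {R : realType}.

Lemma ln_le_sub1 (x : R) : 0 < x -> ln x <= x - 1.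
Proof. by move=> x0; have := @le_ln1Dx R (x - 1); rewrite addrCA subrr addr0; apply; lra. Qed.

(* [ln x = 2 ln (sqrt x) <= 2 (sqrt x - 1)], and [x - 1 - 2 (sqrt x - 1)] is
   the square of [sqrt x - 1]. *)
Lemma ln_le_sub1_sqr (x : R) : 0 < x ->
  ln x <= x - 1 - (`|x - 1| / (x + 2)) ^+ 2.
Proof.
move=> x0; set s := Num.sqrt x; have s0 : 0 < s by rewrite sqrtr_gt0.
have xs : x = s ^+ 2 by rewrite sqr_sqrtr // ltW.
have lnx : ln x <= 2 * (s - 1).
  rewrite xs lnXn // mulr2n; have := ln_le_sub1 s0; lra.
apply: (le_trans lnx).
suff : (`|x - 1| / (x + 2)) ^+ 2 <= (s - 1) ^+ 2 by rewrite xs; nra.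
rewrite expr_div_n real_normK ?num_real // ler_pdivrMr; last by rewrite exprn_gt0; lra.
rewrite -exprMn -subr_ge0 subr_sqr xs.
have -> : ((s - 1) * (s ^+ 2 + 2) - (s ^+ 2 - 1)) *
   ((s - 1) * (s ^+ 2 + 2) + (s ^+ 2 - 1)) =
   (s - 1) ^+ 2 * ((s ^+ 2 - s + 1) * (s ^+ 2 + s + 3)) by ring.
by rewrite mulr_ge0 ?sqr_ge0 // mulr_ge0 //; nra.
Qed.

(** This is ln x <= x - 1 at x = u / v, used in both orders. *)
Lemma dist_ln_le (x y k : R) : 0 < k -> k <= x -> k <= y ->
  `|ln x - ln y| <= `|x - y| / k.
Proof.
move=> k0; have H u v : k <= u -> k <= v -> ln u - ln v <= `|u - v| / k.
  move=> ku kv; have u0 : 0 < u by exact: lt_le_trans ku.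
  have v0 : 0 < v by exact: lt_le_trans kv.
  rewrite -ln_div ?posrE // (le_trans (ln_le_sub1 _)) ?divr_gt0 //.
  rewrite -[X in _ - X](divff (lt0r_neq0 v0)) -mulrBl.
  rewrite (@le_trans _ _ (`|u - v| / v)) //.
    by rewrite ler_wpM2r ?ler_norm // invr_ge0 ltW.
  by rewrite ler_wpM2l // lef_pV2 ?posrE.
move=> kx ky; rewrite ler_norml H // andbT lerNl opprB distrC; exact: H.
Qed.

Variables (t : nat) (deg : nat -> R).
Hypothesis t_gt0 : (0 < t)%N.
Hypothesis deg_ge1 : forall v, (v < t)%N -> 1 <= deg v.

Let W (delta : R) := \sum_(v < t) (deg v + delta).
Let p (delta : R) v := (deg v + delta) / W delta.

Let WE delta : W delta = \sum_(v < t) deg v + t%:R * delta.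
Proof. by rewrite /W big_split /= sumr_const card_ord mulr_natl. Qed.

Let W_ge lo delta : lo <= delta -> t%:R * (1 + lo) <= W delta.
Proof.
move=> ld; rewrite mulr_natl -[X in _ *+ X]card_ord -sumr_const ler_sum // => v _.
by rewrite lerD // deg_ge1.
Qed.

Let W_gt0 delta : -1 < delta -> 0 < W delta.
Proof.
move=> d1; apply: lt_le_trans (W_ge (lexx _)).
by rewrite mulr_gt0 ?ltr0n //; lra.
Qed.

Let p_gt0 delta v : -1 < delta -> (v < t)%N -> 0 < p delta v.
Proof. by move=> d1 vt; rewrite divr_gt0 ?W_gt0 //; have := deg_ge1 vt; lra. Qed.

Lemma sum_attach delta : -1 < delta -> \sum_(v < t) p delta v = 1.
Proof. by move=> d1; rewrite -mulr_suml divff // gt_eqF ?W_gt0. Qed.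

(** Weight and total weight contribute one term each: the former is at least 1 + lo and moves by
    |delta - delta'|, the latter is at least t(1 + lo) and moves by t|delta - delta'|. *)
Lemma dist_ln_attach lo delta delta' v : -1 < lo -> lo <= delta -> lo <= delta' ->
  (v < t)%N ->
  `|ln (p delta v) - ln (p delta' v)| <= 2 * `|delta - delta'| / (1 + lo).
Proof.
move=> lo1 ld ld' vt.
have d1 : -1 < delta by lra.
have d1' : -1 < delta' by lra.
have dv := deg_ge1 vt.
rewrite !ln_div ?posrE ?W_gt0 //; [|lra..].
set A := ln _; set B := ln _; set A' := ln _; set B' := ln _.
rewrite (_ : A - B - (A' - B') = (A - A') + (B' - B)); last by lra.
rewrite (le_trans (ler_normD _ _)) //.
rewrite (_ : 2 * _ / _ = `|delta - delta'| / (1 + lo) + `|delta - delta'| / (1 + lo));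
  last by lra.
have lo0 : 0 < 1 + lo by lra.
have t0 : 0 < t%:R :> R by rewrite ltr0n.
apply: lerD.
  apply: le_trans (dist_ln_le lo0 _ _) _; [lra|lra|].
  by rewrite opprD addrACA subrr add0r.
apply: le_trans (dist_ln_le (mulr_gt0 t0 lo0) (W_ge ld') (W_ge ld)) _.
rewrite !WE opprD addrACA subrr add0r -mulrBr normrM (ger0_norm (ltW t0)).
by rewrite -mulf_div divff ?mul1r ?gt_eqF // distrC.
Qed.

(** The left side is minus a Kullback-Leibler divergence. The logarithm of the ratio x is bounded by
    x - 1, with the quadratic gain on [L]; the linear terms cancel because both laws have mass 1. *)
Lemma attach_divergence (delta delta0 kappa : R) (L : pred nat) :
  -1 < delta -> -1 < delta0 -> 0 <= kappa ->
  (forall v, (v < t)%N -> L v ->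
     kappa <= `|p delta v / p delta0 v - 1| / (p delta v / p delta0 v + 2)) ->
  \sum_(v < t) p delta0 v * (ln (p delta v) - ln (p delta0 v)) <=
  - (kappa ^+ 2 * \sum_(v < t | L v) p delta0 v).
Proof.
move=> d1 d01 k0 H.
have s0 : \sum_(v < t) (p delta v - p delta0 v) = 0.
  by rewrite sumrB !sum_attach // subrr.
rewrite mulr_sumr -sumrN [leRHS]big_mkcond /= -[leRHS]add0r.
apply: le_trans (_ : _ <= \sum_(v < t) (p delta v - p delta0 v) + _) _; last first.
  by rewrite s0.
rewrite -big_split /= ler_sum // => v _.
have pv := p_gt0 d1 (ltn_ord v); have p0v := p_gt0 d01 (ltn_ord v).
rewrite -ln_div ?posrE // [p delta v - _](_ : _ = p delta0 v * (p delta v / p delta0 v - 1));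
  last by rewrite mulrBr mulr1 mulrCA divff ?mulr1 // gt_eqF.
case: ifPn => Lv; last first.
  by rewrite addr0 ler_pM2l // ln_le_sub1 // divr_gt0.
rewrite [kappa ^+ 2 * _]mulrC -mulrBr ler_pM2l //.
apply: le_trans (ln_le_sub1_sqr _) _; first exact: divr_gt0.
rewrite lerD2l lerN2 ler_pXn2r ?nnegrE ?H //.
by rewrite divr_ge0 // addr_ge0 // ltW // divr_gt0.
Qed.

(** Cross-multiplied, the two probabilities differ by (delta - delta0)(S - t deg v), where S is the
    total degree: the gap between the average degree and that of v decides. *)
Lemma attach_ratio_gap (delta delta0 e b r : R) v :
  -1 < delta <= b -> -1 < delta0 <= b -> 0 < e -> e <= `|delta - delta0| ->
  1 <= r -> t%:R * (r + 3^-1) <= \sum_(v < t) deg v ->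
  (v < t)%N -> deg v <= r ->
  e / (3 * (r + b) * (3 * r + 1 + 3 * b)) <=
  `|p delta v / p delta0 v - 1| / (p delta v / p delta0 v + 2).
Proof.
move=> /andP[d1 db] /andP[d01 d0b] e0 ed r1 sr vt dr.
have dv := deg_ge1 vt.
have W0 := W_gt0 d1; have W00 := W_gt0 d01.
have t0 : 0 < t%:R :> R by rewrite ltr0n.
set u := (deg v + delta) * W delta0; set w := (deg v + delta0) * W delta.
have u0 : 0 < u by rewrite mulr_gt0 //; lra.
have w0 : 0 < w by rewrite mulr_gt0 //; lra.
have -> : p delta v / p delta0 v = u / w.
  rewrite /p /u /w invf_div mulf_div; congr (_ / _); exact: mulrC.
have -> : `|u / w - 1| / (u / w + 2) = `|u - w| / (u + 2 * w).
  rewrite -{1}(divff (lt0r_neq0 w0)) -mulrBl normrM normfV (gtr0_norm w0).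
  rewrite -mulrA -invfM; congr (_ / _).
  by rewrite mulrDr mulrCA divff ?mulr1 ?gt_eqF // mulrC.
have -> : u - w = (delta - delta0) * (\sum_(v < t) deg v - t%:R * deg v).
  by rewrite /u /w !WE; ring.
set S := \sum_(v < t) deg v in sr *.
have Sd : t%:R * deg v <= t%:R * r by rewrite ler_pM2l.
have tq : 0 < t%:R * 3^-1 :> R by rewrite mulr_gt0 // invr_gt0.
rewrite mulrDr in sr.
rewrite normrM (ger0_norm (_ : 0 <= S - _)); last by lra.
have rb : 0 < r + b by lra.
have q0 : 0 < 3 * r + 1 + 3 * b by lra.
have Wb x : x <= b -> W x <= S + t%:R * b.
  by move=> xb; rewrite WE lerD2l ler_pM2l.
have Stb : 0 < S + t%:R * b by apply: lt_le_trans (Wb _ db).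
have uw : u + 2 * w <= 3 * ((r + b) * (S + t%:R * b)).
  have : u <= (r + b) * (S + t%:R * b).
    by apply: ler_pM; [lra|exact: ltW|lra|exact: Wb].
  have : w <= (r + b) * (S + t%:R * b).
    by apply: ler_pM; [lra|exact: ltW|lra|exact: Wb].
  lra.
rewrite ler_pdivlMr; last by lra.
apply: (@le_trans _ _ (e / (3 * (r + b) * (3 * r + 1 + 3 * b)) *
    (3 * ((r + b) * (S + t%:R * b))))).
  by rewrite ler_pM2l // divr_gt0 // !mulr_gt0.
have -> : e / (3 * (r + b) * (3 * r + 1 + 3 * b)) *
    (3 * ((r + b) * (S + t%:R * b))) =
    e * ((S + t%:R * b) / (3 * r + 1 + 3 * b)).
  by field; apply/andP; split; apply: lt0r_neq0.
apply: ler_pM => //; [lra | by rewrite divr_ge0 // ltW|].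
rewrite ler_pdivrMr //.
(* The quotient (S - t r) / (S + t b) increases with S; at the least admissible value S = t(r + 1/3)
   it equals 1 / (3 r + 1 + 3 b), whence the constant. *)
apply: (@le_trans _ _ ((S - t%:R * r) * (3 * r + 1 + 3 * b))); last first.
  by rewrite ler_pM2r //; lra.
by nra.
Qed.

End attachment_divergence.

(** * Conditioning on a discrete history *)

Section discrete_conditioning.
Context {d : measure_display} {Omega : measurableType d} {R : realType}.
Variable P : probability Omega R.

(** All preimages have to be measurable, so no sigma-algebra on lists or networks is chosen, and
    every function of such a variable is of the same kind. *)
Definition discrete_rv (T : Type) (f : Omega -> T) : Prop :=
  forall A : set T, measurable (f @^-1` A).

Lemma discrete_rv_factor (S T : Type) (f : Omega -> S) (g : Omega -> T) :
  discrete_rv f -> (forall w w', f w = f w' -> g w = g w') -> discrete_rv g.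
Proof.
move=> mf fg A; rewrite (_ : g @^-1` A = f @^-1` (f @` (g @^-1` A))) //.
apply/seteqP; split=> [w Agw|w [w' Agw' /fg] /=]; first by exists w.
by move=> <-.
Qed.

(** Split along the countably many values of [f]. This handles lists whose length is itself
    random. *)
Lemma discrete_rv_bind (S : countType) (T : Type) (f : Omega -> S)
    (g : S -> Omega -> T) :
  discrete_rv f -> (forall x, discrete_rv (g x)) ->
  discrete_rv (fun w => g (f w) w).
Proof.
move=> mf mg A.
rewrite (_ : _ @^-1` A = \bigcup_x (f @^-1` [set x] `&` g x @^-1` A)).
  apply: countable_bigcupT_measurable => [|x]; first exact: countableP.
  by apply: measurableI; [exact: mf|exact: mg].
by apply/seteqP; split=> [w Agw|w [x _ [/= <-]]] //; exists (f w).
Qed.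

Lemma discrete_rv_cst (T : Type) (x : T) : discrete_rv (fun=> x).
Proof.
move=> A; have [Ax|Ax] := pselect (A x).
  by rewrite (_ : _ @^-1` A = setT) //; apply/seteqP; split.
by rewrite (_ : _ @^-1` A = set0) //; apply/seteqP; split.
Qed.

Lemma discrete_rv_map2 (S S' : countType) (T : Type) (f : Omega -> S)
    (g : Omega -> S') (h : S -> S' -> T) :
  discrete_rv f -> discrete_rv g -> discrete_rv (fun w => h (f w) (g w)).
Proof.
move=> mf mg; apply: (discrete_rv_bind (g := fun x w => h x (g w))) mf _ => x.
apply: (discrete_rv_bind (g := fun y w => h x y)) mg _ => y.
exact: discrete_rv_cst.
Qed.

Lemma discrete_rv_measurable (F : Omega -> R) (D : set Omega) :
  measurable D -> discrete_rv F -> measurable_fun D F.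
Proof. by move=> mD mF _ B mB; apply: measurableI => //; exact: mF. Qed.

(* Every [w] stands for its atom [Y @^-1` [set Y w]]: conditioning on [Y] only
   needs the conditional law [q w] of [Z] on each atom. *)
Section atoms.
Variables (Y Z : Omega -> nat) (D : set Omega) (t : nat).
Hypotheses (mY : discrete_rv Y) (mZ : discrete_rv Z).
Hypothesis D_atoms : forall w w', Y w = Y w' -> D w -> D w'.
Hypothesis Z_lt : forall w, D w -> (Z w < t)%N.
Variable q : Omega -> nat -> R.
Hypothesis q_atoms : forall w w', D w -> Y w = Y w' -> q w = q w'.
Hypothesis q_ge0 : forall w j, D w -> (j < t)%N -> 0 <= q w j.
Hypothesis qE : forall w j, D w -> (j < t)%N ->
  P (Y @^-1` [set Y w] `&` Z @^-1` [set j]) =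
  ((q w j)%:E * P (Y @^-1` [set Y w]))%E.

Let mD : measurable D.
Proof.
rewrite (_ : D = Y @^-1` (Y @` D)) //.
apply/seteqP; split=> [w Dw|w [w' Dw' /D_atoms] /=]; first by exists w.
exact.
Qed.

Let mYD (F : Omega -> R) : (forall w w', D w -> Y w = Y w' -> F w = F w') ->
  measurable_fun D F.
Proof.
move=> FY _ B mB.
rewrite (_ : _ `&` _ = D `&` Y @^-1` (Y @` (D `&` F @^-1` B))).
  by apply: measurableI => //; exact: mY.
apply/seteqP; split=> [w [Dw BF]|w [Dw [w' [Dw' BF]] Yw]]; first by split=> //; exists w.
by split=> //=; rewrite -(FY _ _ Dw' Yw).
Qed.

Let mYZD (F : Omega -> R) :
  (forall w w', D w -> Y w = Y w' -> Z w = Z w' -> F w = F w') ->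
  measurable_fun D F.
Proof.
move=> FYZ _ B mB; set YZ := fun w => (Y w, Z w).
have mYZ : discrete_rv YZ by exact: discrete_rv_map2.
rewrite (_ : _ `&` _ = D `&` YZ @^-1` (YZ @` (D `&` F @^-1` B))).
  by apply: measurableI => //; exact: mYZ.
apply/seteqP; split=> [w [Dw BF]|w [Dw [w' [Dw' BF]] [Yw Zw]]].
  by split=> //; exists w.
by split=> //=; rewrite -(FYZ _ _ Dw' Yw Zw).
Qed.

(** On one atom [q] and [phi] are constant, so integrating out [Z] is a finite sum against its
    conditional law; then the atoms are summed. Nonnegativity replaces integrability. *)
Lemma integral_atoms (phi : Omega -> nat -> R) :
  (forall w w', D w -> Y w = Y w' -> phi w = phi w') ->
  (forall w j, D w -> 0 <= phi w j) ->
  (\int[P]_(w in D) (phi w (Z w))%:E =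
   \int[P]_(w in D) (\sum_(j < t) q w j * phi w j)%:E)%E.
Proof.
move=> phiY phi0.
pose E k := D `&` Y @^-1` [set k].
have DE : D = \bigcup_k E k.
  by apply/seteqP; split=> [w Dw|w [k _ []]] //; exists (Y w).
have mE k : measurable (E k) by apply: measurableI => //; exact: mY.
have tE : trivIset setT E.
  by move=> i j _ _ [w [[_ <-] [_ <-]]].
have m1 : measurable_fun D (fun w => phi w (Z w)).
  apply: mYZD => w w' Dw Yw Zw.
  by rewrite Zw (phiY _ _ Dw Yw).
have m2 : measurable_fun D (fun w => \sum_(j < t) q w j * phi w j).
  apply: mYD => w w' Dw Yw.
  by apply: eq_bigr => j _; rewrite (phiY _ _ Dw Yw) (q_atoms Dw Yw).
rewrite [in LHS]DE [in RHS]DE !ge0_integral_bigcup -?DE //; last 4 first.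
- exact/measurable_EFinP.
- move=> w Dw; rewrite lee_fin sumr_ge0 // => j _.
  by rewrite mulr_ge0 ?phi0 ?q_ge0.
- exact/measurable_EFinP.
- by move=> w Dw; rewrite lee_fin; apply: phi0.
apply: eq_eseriesr => k _.
have [[w0 [Dw0 Yw0]]|E0] := pselect (E k !=set0); last first.
  have -> : E k = set0 by apply/seteqP; split=> // w Ew; apply: E0; exists w.
  by rewrite !integral_set0.
have EY : E k = Y @^-1` [set Y w0].
  apply/seteqP; split=> [w [_ Yw]|w Yw] /=; first by rewrite Yw0.
  split; last by rewrite -Yw0.
  by apply: D_atoms Dw0; rewrite Yw.
have Ew0 w : E k w -> Y w0 = Y w by move=> [_ /= ->]; rewrite -Yw0.
(* On the atom of [w0], the integrand is the sum over j of [phi w0 j] times the indicator of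
   [Z = j]. *)
rewrite (_ : (\int[P]_(w in E k) (phi w (Z w))%:E)%E =
  (\int[P]_(w in E k) \sum_(j < t) ((phi w0 j)%:E * (\1_(Z @^-1` [set nat_of_ord j]) w)%:E))%E).
  rewrite ge0_integral_sum //; last 2 first.
  - move=> j; apply: measurable_funeM; apply/measurable_EFinP.
    by apply: measurable_indic; exact: mZ.
  - by move=> j w _; rewrite -EFinM lee_fin mulr_ge0 // phi0.
  rewrite (_ : (\int[P]_(w in E k) _)%E =
    (\int[P]_(w in E k) cst (\sum_(j < t) q w0 j * phi w0 j)%:E w)%E); last first.
    apply: eq_integral => w; rewrite inE => Ew; congr EFin.
    by rewrite (q_atoms Dw0 (Ew0 _ Ew)) (phiY _ _ Dw0 (Ew0 _ Ew)).
  rewrite integral_cst // -sumEFin ge0_sume_distrl; last first.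
    by move=> j _; rewrite lee_fin mulr_ge0 ?phi0 ?q_ge0.
  apply: eq_bigr => j _; rewrite ge0_integralZl //; last 2 first.
  - apply/measurable_EFinP.
    by apply: measurable_indic; exact: mZ.
  - by rewrite lee_fin phi0.
  rewrite integral_indic //.
  rewrite [X in (_ * X)%E](_ : _ = (q w0 j)%:E * P (E k))%E; last first.
    by rewrite EY (setIC (Z @^-1` _)); exact: qE.
  by rewrite EFinM muleA [X in (X * _)%E]muleC.
apply: eq_integral => w; rewrite inE => Ew.
have Zt : (Z w < t)%N by apply: Z_lt; case: Ew.
rewrite (bigD1 (Ordinal Zt)) //= big1 ?adde0.
  by rewrite indicE mem_set //= mule1 (phiY _ _ Dw0 (Ew0 _ Ew)).
move=> j /eqP jZ; rewrite indicE memNset ?mule0 // => /= Zj.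
by apply: jZ; exact/val_inj.
Qed.

(* The centered increment is orthogonal to [F], which is constant on atoms. *)
Lemma integral_sqr_centered (F : Omega -> R) (g : Omega -> nat -> R) (B : R) :
  (forall w w', D w -> Y w = Y w' -> F w = F w') ->
  (forall w w', D w -> Y w = Y w' -> g w = g w') ->
  (forall w j, D w -> (j < t)%N -> `|g w j| <= B) ->
  (forall w, D w -> \sum_(j < t) q w j = 1) ->
  (\int[P]_(w in D)
     ((F w + (g w (Z w) - \sum_(j < t) q w j * g w j)) ^+ 2)%:E <=
   \int[P]_(w in D) (F w ^+ 2)%:E + (B ^+ 2)%:E * P D)%E.
Proof.
move=> FY gY gB q1.
rewrite (@integral_atoms
  (fun w j => (F w + (g w j - \sum_(j < t) q w j * g w j)) ^+ 2)); last 2 first.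
- by move=> w w' Dw Yw; rewrite (FY _ _ Dw Yw) (gY _ _ Dw Yw) (q_atoms Dw Yw).
- by move=> w j _; rewrite sqr_ge0.
have mF2 : measurable_fun D (fun w => F w ^+ 2).
  by apply: mYD => w w' Dw /(FY _ _ Dw) ->.
rewrite -integral_cst // -ge0_integralD //; last 3 first.
- by move=> w _; rewrite lee_fin sqr_ge0.
- exact/measurable_EFinP.
- by move=> w _; rewrite lee_fin sqr_ge0.
apply: ge0_le_integral => //.
- by move=> w Dw; rewrite lee_fin sumr_ge0 // => j _; rewrite mulr_ge0 ?q_ge0 ?sqr_ge0.
- apply/measurable_EFinP; apply: mYD => w w' Dw Yw.
  by rewrite (FY _ _ Dw Yw) (gY _ _ Dw Yw) (q_atoms Dw Yw).
- by apply: emeasurable_funD => //; exact/measurable_EFinP.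
move=> w Dw; rewrite -EFinD lee_fin.
set a := \sum_(j < t) q w j * g w j.
(* As [q] has mass 1 and mean [a], the cross term vanishes. The term [- a ^+ 2] is dropped
   afterwards and the second moment of [g] is at most [B ^+ 2]. *)
have -> : \sum_(j < t) q w j * (F w + (g w j - a)) ^+ 2 =
    F w ^+ 2 + \sum_(j < t) q w j * g w j ^+ 2 - a ^+ 2.
  rewrite (eq_bigr (fun j : 'I_t => q w j * (F w - a) ^+ 2 +
    (2 * (F w - a) * (q w j * g w j) + q w j * g w j ^+ 2))); last first.
    by move=> j _; ring.
  rewrite !big_split /= -mulr_suml q1 // -mulr_sumr -/a; ring.
rewrite -addrA lerD2l lerBlDr -[leLHS]addr0 lerD ?sqr_ge0 //.
rewrite -[leRHS]mul1r -(q1 w Dw) mulr_suml ler_sum // => j _.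
rewrite ler_wpM2l ?q_ge0 // -real_normK ?num_real //.
by rewrite ler_pXn2r ?nnegrE ?gB // (le_trans _ (gB w j _ _)).
Qed.

End atoms.
End discrete_conditioning.

(** * Markov and Chebyshev inequalities *)

Section markov_inequality.
Context {d : measure_display} {Omega : measurableType d} {R : realType}.
Variable P : probability Omega R.

Lemma markov_ge0 (F : Omega -> R) (x V : R) : measurable_fun setT F ->
  (forall w, 0 <= F w) -> 0 < x -> (\int[P]_w (F w)%:E <= V%:E)%E ->
  (P [set w | (x <= F w)%R] <= (V / x)%:E)%E.
Proof.
move=> mF F0 x0 FV.
have mF' : measurable_fun setT (EFin \o F) by exact/measurable_EFinP.
have H := le_integral_abse P measurableT mF' x0.
rewrite EFinM lee_pdivlMr //; apply: le_trans FV; rewrite muleC.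
apply: le_trans (le_trans _ H) _.
  rewrite setTI le_eqVlt; apply/orP; left; apply/eqP; congr (_ * P _)%E.
  by apply/seteqP; split=> w /=; rewrite lee_fin ger0_norm.
rewrite le_eqVlt; apply/orP; left; apply/eqP; apply: eq_integral => w _ /=.
by rewrite ger0_norm.
Qed.

Lemma chebyshev_sqr (F : Omega -> R) (x V : R) : measurable_fun setT F ->
  0 < x -> (\int[P]_w (F w ^+ 2)%:E <= V%:E)%E ->
  (P [set w | (x <= `|F w|)%R] <= (V / x ^+ 2)%:E)%E.
Proof.
move=> mF x0 FV.
have -> : [set w | x <= `|F w|] = [set w | x ^+ 2 <= F w ^+ 2].
  apply/seteqP; split=> w /=; rewrite -(@real_normK _ (F w)) ?num_real //;
    by rewrite ler_pXn2r // nnegrE ltW.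
by apply: markov_ge0 => // [|w|]; [exact: measurable_funX|exact: sqr_ge0|exact: exprn_gt0].
Qed.

End markov_inequality.

(** * Hitting vertices of small degree *)

Section realization_drift.
Context {R : realType}.
Variables (m : nat -> nat) (c : nat -> nat -> nat).
Hypothesis m_gt0 : forall t, (0 < t)%N -> (0 < m t)%N.
Hypothesis c_lt : forall t i, (2 <= t)%N -> (i < m t)%N -> (c t i.+1 < t)%N.
Local Notation D := (chosen_degree m c).
Local Notation ap := (attach_prob m c).

Let deg_ge1 t i : (2 <= t)%N ->
  forall v, (v < t)%N -> 1 <= (degree (PA_step m c t i) v)%:R :> R.
Proof. by move=> t2 v vt; rewrite ler1n; exact: (degree_step_gt0 m_gt0 c_lt). Qed.

Lemma loglik_lipschitz (lo delta delta' : R) n : -1 < lo -> lo <= delta ->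
  lo <= delta' ->
  `|loglik m c n delta - loglik m c n delta'| <=
  2 * `|delta - delta'| / (1 + lo) * (\sum_(1 <= t < n.+1) m t)%:R.
Proof.
move=> lo1 ld ld'; rewrite /loglik -sumrB (le_trans (ler_norm_sum _ _ _)) //.
have k0 : 0 <= 2 * `|delta - delta'| / (1 + lo).
  by rewrite divr_ge0 ?mulr_ge0 //; lra.
apply: (@le_trans _ _ (2 * `|delta - delta'| / (1 + lo) *
    (\sum_(2 <= t < n.+1) m t)%:R)); last first.
  rewrite ler_wpM2l // ler_nat; case: n => [|n]; first by rewrite big_geq.
  by rewrite [leqRHS]big_ltn // leq_addl.
rewrite natr_sum mulr_sumr !big_nat; apply: ler_sum => t /andP[t2 _].
rewrite -sumrB (le_trans (ler_norm_sum _ _ _)) //.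
rewrite mulr_natr -[X in _ *+ X]subn0 -sumr_const_nat !big_nat.
apply: ler_sum => i /andP[_ im].
exact: (dist_ln_attach (ltnW t2) (deg_ge1 i t2) lo1 ld ld' (c_lt t2 im)).
Qed.

Definition hit_prob (delta0 : R) r t i : R :=
  \sum_(j < t | (degree (PA_step m c t i) j <= r)%N) ap t i j delta0.

Lemma ap_ge0 (delta0 : R) t i j : -1 < delta0 -> (2 <= t)%N -> (j < t)%N ->
  0 <= ap t i j delta0.
Proof.
move=> d1 t2 jt; rewrite divr_ge0 //; first by have := deg_ge1 i t2 jt; lra.
by apply/ltW; exact: total_weight_gt0.
Qed.

Lemma hit_prob_ge0 (delta0 : R) r t i : -1 < delta0 -> (2 <= t)%N ->
  0 <= hit_prob delta0 r t i.
Proof. by move=> d1 t2; rewrite sumr_ge0 // => j _; rewrite ap_ge0. Qed.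

Lemma hit_prob_le1 (delta0 : R) r t i : -1 < delta0 -> (2 <= t)%N ->
  hit_prob delta0 r t i <= 1.
Proof.
move=> d1 t2; rewrite -(sum_attach (ltnW t2) (deg_ge1 i t2) d1).
rewrite /hit_prob big_mkcond ler_sum // => j _; case: ifP => // _.
exact: ap_ge0.
Qed.

Lemma drift_le (delta delta0 b e : R) r t i : (3 <= t)%N -> (i <= m t)%N ->
  -1 < delta <= b -> -1 < delta0 <= b -> 0 < e -> e <= `|delta - delta0| ->
  (0 < r)%N -> (forall s, (1 <= s < t)%N -> (r <= m s)%N) ->
  \sum_(j < t) ap t i j delta0 * (ln (ap t i j delta) - ln (ap t i j delta0)) <=
  - ((e / (3 * (r%:R + b) * (3 * r%:R + 1 + 3 * b))) ^+ 2 * hit_prob delta0 r t i).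
Proof.
move=> t3 im d1 d01 e0 ed r0 rm; have t2 : (2 <= t)%N by exact: ltnW.
have /andP[d1' db] := d1; have /andP[d01' d0b] := d01.
have r1 : 1 <= r%:R :> R by rewrite ler1n.
apply: (@attach_divergence _ t
  (fun v => (degree (PA_step m c t i) v)%:R) _ _ delta delta0 _
  (fun v => (degree (PA_step m c t i) v <= r)%N)) => //.
- exact: ltnW.
- exact: deg_ge1.
- by apply: divr_ge0; [lra|apply: mulr_ge0; lra].
move=> v vt dr; apply: (@attach_ratio_gap _ t
  (fun v => (degree (PA_step m c t i) v)%:R) _ _ delta delta0 e b r%:R v) => //.
- exact: ltnW.
- exact: deg_ge1.
- rewrite -natr_sum (degree_total c_lt) //.
  (* The total degree is at least 2 r (t - 1), and r (t - 2) >= t / 3 because r >= 1 and t >= 3. *)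
  apply: (@le_trans _ _ (2 * (r * t.-1))%:R).
    have : (t%:R : R) = t.-1%:R + 1 by rewrite natr1 prednK // ltnW.
    have : 2 <= t.-1%:R :> R by rewrite ler_nat; lia.
    by rewrite !natrM => h1 h2; nra.
  rewrite ler_nat (leq_trans _ (leq_addr _ _)) // leq_mul2l /=.
  by rewrite -subn1 mulnC -sum_nat_const_nat !big_nat leq_sum.
- by rewrite ler_nat.
Qed.

(** This is [attach_divergence] with gap 0 and threshold 0, which selects no vertex. It serves for
    the edges of v_2, where the average degree may be too small for [drift_le]. *)
Lemma drift_le0 (delta delta0 : R) t i : (2 <= t)%N ->
  -1 < delta -> -1 < delta0 ->
  \sum_(j < t) ap t i j delta0 * (ln (ap t i j delta) - ln (ap t i j delta0)) <= 0.
Proof.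
move=> t2 d1 d01; rewrite -[leRHS]oppr0 -[X in - X](mul0r (hit_prob delta0 0 t i)).
rewrite -[X in X * _](expr0n R 2).
apply: (@attach_divergence _ t
  (fun v => (degree (PA_step m c t i) v)%:R) _ _ delta delta0 _
  (fun v => (degree (PA_step m c t i) v <= 0)%N)) => //.
- exact: ltnW.
- exact: deg_ge1.
by move=> v vt; rewrite leqNgt (degree_step_gt0 m_gt0 c_lt).
Qed.

Definition low_count r n : nat := \sum_(v < n.+1) (degree (PA m c n) v <= r).
Definition hit_count r n : nat :=
  \sum_(2 <= t < n.+1) \sum_(0 <= i < m t) (D t i <= r)%N.

(** The number [l] counts the edges that hit a vertex of degree exactly r: these are the moments
    when a vertex stops being low. *)
Lemma low_countE r n : (0 < n)%N ->
  exists l, (low_count r n + l = (m 1 <= r) + \sum_(1 <= t < n.+1) (m t <= r) /\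
   l <= hit_count r n)%N.
Proof.
move=> n0; exists (\sum_(2 <= t < n.+1) \sum_(0 <= i < m t) (D t i == r))%N; split.
  have := sum_degree c_lt (fun d => Posz (d <= r)%N) n0.
  rewrite -!(big_morph Posz PoszD (erefl _)) -/(low_count r n) => E.
  apply/eqP; rewrite -eqz_nat !PoszD E -addrA [X in _ + X](_ : _ = 0) ?addr0 //.
  rewrite (big_morph Posz PoszD (erefl _)) -big_split /= big1 // => t _.
  rewrite (big_morph Posz PoszD (erefl _)) -big_split /= big1 // => i _.
  by case: ltngtP.
by apply: leq_sum => t _; apply: leq_sum => i _; case: eqP => // ->; rewrite leqnn.
Qed.

(** Only the new vertex can join the low ones; hits can only remove some. *)
Lemma low_count_step r n : (0 < n)%N -> (low_count r n.+1 <= (low_count r n).+1)%N.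
Proof.
move=> n0.
have := sum_degree c_lt (fun d => Posz (d <= r)%N) n0.
have := sum_degree c_lt (fun d => Posz (d <= r)%N) (ltnW (n0 : (1 < n.+1)%N)).
rewrite -!(big_morph Posz PoszD (erefl _)) -!/(low_count r _).
rewrite (@big_nat_recr _ _ _ n.+1 1) //= (@big_nat_recr _ _ _ n.+1 2) //=.
set S := \sum_(0 <= i < _) _ => E1 E2.
have : S <= 0 by rewrite /S sumr_le0 // => i _; case: ltngtP.
move: E1 E2; rewrite -(lez_nat (low_count r n.+1)) intS => -> ->; rewrite PoszD.
move: S (\sum_(2 <= t < n.+1) _) (\sum_(1 <= t < n.+1) _)%N => S Q A.
by case: (m n.+1 <= r)%N; case: (m 1 <= r)%N => /=; lia.
Qed.

Lemma low_count_back r n k : (k < n)%N ->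
  (low_count r n <= low_count r (n - k) + k)%N.
Proof.
elim: k => [|k IH] kn; first by rewrite subn0 addn0.
apply: leq_trans (IH (ltnW kn)) _.
rewrite (_ : n - k = (n - k.+1).+1)%N; last by lia.
by have := @low_count_step r (n - k.+1) ltac:(lia); lia.
Qed.

(** Each low vertex has weight at least 1 + delta0. Only the first edge of v_t is considered, since
    PA_{t,0} is the network at time t - 1. *)
Lemma hit_prob_low_count (delta0 K : R) r t : -1 < delta0 -> (2 <= t)%N ->
  total_weight m c t 0 delta0 <= K ->
  (low_count r t.-1)%:R * (1 + delta0) / K <= hit_prob delta0 r t 0.
Proof.
move=> d1 t2 WK; have W0 := total_weight_gt0 m_gt0 c_lt 0 t2 d1.
rewrite /hit_prob /low_count prednK ?(ltnW t2) // natr_sum !mulr_suml.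
rewrite [leRHS]big_mkcond ler_sum // => j _ /=; rewrite PA_step0.
case: ifP => _ /=; last by rewrite !mul0r.
have jd := deg_ge1 0 t2 (ltn_ord j); rewrite PA_step0 in jd.
rewrite mul1r /attach_prob PA_step0 ler_pM //; [lra| |lra|].
  by rewrite invr_ge0 (le_trans (ltW W0)).
by rewrite lef_pV2 ?posrE // (lt_le_trans W0).
Qed.

Definition sum_hit_prob (delta0 : R) r n : R :=
  \sum_(2 <= t < n.+1) \sum_(0 <= i < m t) hit_prob delta0 r t i.

(** One entry for each case of the next lemma: many hits, or many survivors. The second is a lower
    bound for the hitting probability in one late step, times the fraction p / 16 of such steps. *)
Definition hit_rate (p K delta0 : R) : R :=
  Num.min (p / 8) (p / 8 * (1 + delta0) / (2 * K + `|delta0|) * (p / 16)).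

(* Either a positive fraction of the vertices of small initial degree were hit
   while their degree was small, or a positive fraction of them survived; in
   the latter case they were already there during the last [p n / 8] steps. *)
Lemma sum_hit_prob_ge (delta0 p K : R) r n : -1 < delta0 -> 0 < p <= 1 ->
  0 < K -> 16 / p <= n%:R -> (2 <= n)%N ->
  (\sum_(1 <= t < n.+1) m t)%:R <= K * n%:R ->
  p / 2 * n%:R <= (\sum_(1 <= t < n.+1) (m t <= r))%:R ->
  (hit_count r n)%:R - p / 8 * n%:R <= sum_hit_prob delta0 r n ->
  hit_rate p K delta0 * n%:R <= sum_hit_prob delta0 r n.
Proof.
move=> d1 /andP[p0 p1] K0 np n2 MK A_ge HS.
have nR : 0 < n%:R :> R by rewrite ltr0n ltnW.
have [l [Nl lH]] := low_countE r (ltnW n2).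
have [H_ge|H_lt] := lerP (p / 4 * n%:R) (hit_count r n)%:R.
  apply: le_trans HS; apply: (@le_trans _ _ (p / 8 * n%:R)); last by lra.
  by rewrite ler_pM2r // ge_min lexx.
have N_ge : p / 4 * n%:R <= (low_count r n)%:R.
  have : (low_count r n)%:R + l%:R >= (\sum_(1 <= t < n.+1) (m t <= r))%:R :> R.
    by rewrite -natrD ler_nat Nl leq_addl.
  have : l%:R <= (hit_count r n)%:R :> R by rewrite ler_nat.
  lra.
(* Going back at most [k] steps loses at most [k <= p n / 8] of the [p n / 4] low vertices. The
   bound [16 / p <= n] absorbs the rounding and gives [k >= p n / 16]. *)
set q := p / 8 * n%:R; have q0 : 0 <= q by rewrite /q; nra.
have /andP[kq qk] := truncn_itv q0; set k := Num.truncn q in kq qk.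
have kn : (k < n)%N.
  by rewrite -(ltr_nat R) (le_lt_trans kq) // /q; nra.
have k_ge : p / 16 * n%:R <= k%:R.
  move: qk; rewrite -natr1 /q => qk.
  have : 16 <= n%:R * p by rewrite -ler_pdivrMr.
  by nra.
set h0 := p / 8 * (1 + delta0) / (2 * K + `|delta0|).
have h00 : 0 <= h0.
  rewrite divr_ge0 // ?addr_ge0 ?mulr_ge0 //; lra.
have W_le t : (2 <= t <= n)%N ->
    total_weight m c t 0 delta0 <= (2 * K + `|delta0|) * n%:R.
  move=> /andP[t2 tn]; rewrite /total_weight big_split /= sumr_const card_ord.
  rewrite -natr_sum (degree_total c_lt) // addn0 mulrDl lerD //.
    rewrite natrM -mulrA ler_pM2l // (le_trans _ MK) // ler_nat.
    by rewrite [leqRHS](@big_cat_nat _ _ _ t 1 n.+1) ?(ltnW t2) ?leqW ?leq_addr.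
  rewrite -[delta0 *+ t]mulr_natr (le_trans (ler_norm _)) // normrM normr_nat ler_wpM2l //.
  by rewrite ler_nat.
have late (N k' j : nat) : (k' < N -> N - k' < j <= N ->
    [/\ 2 <= j, N - j.-1 <= k', N - j.-1 < N & j.-1 <= N])%N.
  by clear; move=> H1 H2; split; lia.
have h_ge j : (n - k < j <= n)%N -> h0 <= hit_prob delta0 r j 0.
  move=> kj; have [j2 jk jn j1n] := late n k j kn kj.
  have {}kj : (j <= n)%N by case/andP: kj.
  apply: le_trans (hit_prob_low_count r d1 j2 (W_le j _)); last by rewrite j2.
  have N_j : p / 8 * n%:R <= (low_count r j.-1)%:R.
    have := @low_count_back r n (n - j.-1) jn.
    rewrite subKn //.
    rewrite -(ler_nat R) natrD; have : (n - j.-1)%:R <= k%:R :> R by rewrite ler_nat.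
    by rewrite /q in kq; lra.
  have Z0 : 0 < 2 * K + `|delta0| by rewrite ltr_pwDl // mulr_gt0.
  rewrite ler_pdivlMr ?mulr_gt0 //.
  rewrite (_ : h0 * _ = p / 8 * n%:R * (1 + delta0)); last first.
    by rewrite /h0; field; rewrite gt_eqF.
  by rewrite ler_pM2r //; lra.
apply: (@le_trans _ _ (h0 * k%:R)).
  apply: (@le_trans _ _ (h0 * (p / 16 * n%:R))); last by rewrite ler_wpM2l.
  by rewrite mulrA ler_pM2r // ge_min lexx orbT.
rewrite /sum_hit_prob (@big_cat_nat _ _ _ (n - k).+1 2 n.+1) //=; last 2 first.
- by rewrite ltnS subn_gt0.
- by rewrite ltnS leq_subr.
rewrite -[leLHS]add0r lerD //.
  rewrite big_nat sumr_ge0 // => t /andP[t2 _]; rewrite sumr_ge0 // => i _.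
  exact: hit_prob_ge0.
(* Each of the last [k] steps contributes at least [h0] through its first edge alone. *)
rewrite mulr_natr -[k in leLHS](subKn (ltnW kn)) -subSS.
rewrite -sumr_const_nat !big_nat; apply: ler_sum => t tn.
have [t2 _ _ _] := late n k t kn tn.
rewrite big_ltn ?m_gt0 ?(ltnW t2) // -[leLHS]addr0 lerD //; first exact: h_ge.
by rewrite sumr_ge0 // => i _; exact: hit_prob_ge0.
Qed.

(** The strict gain starts at v_3. The edges of v_2 have drift at most 0, and their hitting
    probabilities, at most [m 2] in total, are given away. *)
Lemma sum_drift_le (delta delta0 b e : R) r n : (2 <= n)%N ->
  -1 < delta <= b -> -1 < delta0 <= b -> 0 < e -> e <= `|delta - delta0| ->
  (0 < r)%N -> (forall s, (1 <= s <= n)%N -> (r <= m s)%N) ->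
  \sum_(2 <= t < n.+1) \sum_(0 <= i < m t)
    \sum_(j < t) ap t i j delta0 * (ln (ap t i j delta) - ln (ap t i j delta0)) <=
  - ((e / (3 * (r%:R + b) * (3 * r%:R + 1 + 3 * b))) ^+ 2 *
    (sum_hit_prob delta0 r n - (m 2)%:R)).
Proof.
move=> n2 d1 d01 e0 ed r0 rm.
have /andP[d1' db] := d1; have /andP[d01' d0b] := d01.
set k := _ ^+ 2; have k0 : 0 <= k by exact: sqr_ge0.
rewrite /sum_hit_prob big_ltn // [in leRHS]big_ltn //.
apply: (@le_trans _ _ (0 - k * \sum_(3 <= t < n.+1) \sum_(0 <= i < m t)
    hit_prob delta0 r t i)); last first.
  rewrite sub0r lerN2 ler_wpM2l // lerBlDr addrC lerD2l.
  rewrite -[X in _ <= X%:R]subn0 -sumr_const_nat ler_sum // => i _.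
  exact: hit_prob_le1.
apply: lerD; first by rewrite sumr_le0 // => i _; exact: drift_le0.
rewrite mulr_sumr -sumrN !big_nat; apply: ler_sum => t /andP[t3 tn].
rewrite mulr_sumr -sumrN !big_nat; apply: ler_sum => i /andP[_ im].
apply: drift_le => //; first exact: ltnW.
by move=> s st; apply: rm; lia.
Qed.

End realization_drift.

(** * The random network *)

Lemma size_PA m c t : size (PA m c t) = (\sum_(1 <= s < t.+1) m s)%N.
Proof.
elim: t => [|t IH]; first by rewrite big_geq.
case: t IH => [|t] IH; first by rewrite PA_1 size_nseq big_nat1.
by rewrite PA_succ // [RHS]big_nat_recr //= -IH size_cat size_map size_iota.
Qed.

Lemma new_edges_inj (c c' : nat -> nat -> nat) t i : new_edges c t i = new_edges c' t i ->
  forall l, (l < i)%N ->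
  new_edges c t l = new_edges c' t l /\ c t l.+1 = c' t l.+1.
Proof.
elim: i => [|i IH] //; rewrite !new_edgesS => /rcons_inj[E Ec] l.
by rewrite ltnS leq_eqVlt => /predU1P[->//|/(IH E)].
Qed.

(** Edges are listed in order of appearance and the initial degrees fix the lengths of the blocks,
    so equal lists agree block by block: the network remembers its whole construction. *)
Lemma PA_step_inj (m m' : nat -> nat) (c c' : nat -> nat -> nat) t i :
  (2 <= t)%N -> (forall s, (0 < s <= t)%N -> m s = m' s) ->
  PA_step m c t i = PA_step m' c' t i ->
  (forall s l, (2 <= s < t)%N -> (l < m s)%N ->
     PA_step m c s l = PA_step m' c' s l /\ c s l.+1 = c' s l.+1) /\
  (forall l, (l < i)%N ->
     PA_step m c t l = PA_step m' c' t l /\ c t l.+1 = c' t l.+1).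
Proof.
move=> t2; have {t2} [u ->] : exists u, t = u.+2 by exists t.-2; lia.
elim: u i => [|u IH] i mm E.
- have /eqP := E; rewrite eqseq_cat; last first.
    by rewrite !size_PA; apply: eq_big_nat => s ?; apply: mm; lia.
  move=> /andP[/eqP E1 /eqP /new_edges_inj E2].
  split=> [s l|l /E2[E3 ->]]; first by lia.
  by rewrite /PA_step E1 E3.
- have /eqP := E; rewrite eqseq_cat; last first.
    by rewrite !size_PA; apply: eq_big_nat => s ?; apply: mm; lia.
  move=> /andP[/eqP E1 /eqP /new_edges_inj E2].
  split=> [s l sl lm|l /E2[E3 ->]]; last by rewrite /PA_step E1 E3.
  have mu : m u.+2 = m' u.+2 by apply: mm; lia.
  have {}E1 : PA m c u.+2 = PA m' c' u.+2 by [].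
  move: E1; rewrite !(@PA_succ _ _ u.+2) // -mu => /IH[s0 s0u|H1 H2].
    by apply: mm; lia.
  have [su|us] := ltnP s u.+2; first by apply: H1 => //; lia.
  by have su : s = u.+2 by [lia]; subst s; apply: H2.
Qed.

Section sigma_algebra_bigcap.
Context {T : Type} (G : set (set T)).

Lemma g_sigma_algebra_bigcap (A : nat -> set T) :
  (forall k, <<s G >> (A k)) -> <<s G >> (\bigcap_k A k).
Proof.
move=> GA; have [_ GC GU] := smallest_sigma_algebra [set: T] G.
rewrite -[X in <<s _ >> X]setCK setC_bigcap -setTD; apply: (GC); apply: GU => k.
by rewrite -setTD; exact: GC.
Qed.

Lemma g_sigma_algebraT : <<s G >> setT.
Proof.
have [G0 GC _] := smallest_sigma_algebra [set: T] G.
by have := GC _ G0; rewrite setD0.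
Qed.

End sigma_algebra_bigcap.

Section random_model.
Context {d : measure_display} {Omega : measurableType d} {R : realType}.
Variable P : probability Omega R.
Variables (m : nat -> {RV P >-> nat}) (c : nat -> nat -> {RV P >-> nat}).
Variable delta0 : R.
Hypothesis hPA : is_PA m c delta0.

Local Notation PAs t i := (fun w => PA_step (m_at m w) (c_at c w) t i).

Let m_gt0 w t : (0 < t)%N -> (0 < m_at m w t)%N.
Proof. by case: hPA => -[H _ _ _] _; exact: H. Qed.

Let c_lt w t i : (2 <= t)%N -> (i < m_at m w t)%N -> (c_at c w t i.+1 < t)%N.
Proof. by move=> t2 im; case: hPA => _ /(_ t i.+1 t2 isT)[+ _]; exact. Qed.

Lemma discrete_rv_nat (X : {RV P >-> nat}) : discrete_rv X.
Proof. by move=> A; rewrite -[X in measurable X]setTI; exact: measurable_funPT. Qed.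

Lemma discrete_rv_seq (S T : countType) (f : S -> Omega -> T) (s : seq S) :
  (forall x, discrete_rv (f x)) -> discrete_rv (fun w => [seq f x w | x <- s]).
Proof.
move=> mf; elim: s => [|x s IH] /=; first exact: discrete_rv_cst.
exact: (discrete_rv_map2 cons (mf x) IH).
Qed.

Lemma discrete_rv_new_edges t i :
  discrete_rv (fun w => new_edges (c_at c w) t i).
Proof.
apply: (@discrete_rv_seq _ _ (fun l w => (t, c t l w))) => l.
apply: (discrete_rv_map2 (fun x y => (x, y))); first exact: discrete_rv_cst.
exact: discrete_rv_nat.
Qed.

Lemma discrete_rv_PA t : discrete_rv (fun w => PA (m_at m w) (c_at c w) t).
Proof.
elim: t => [|t IH]; first exact: discrete_rv_cst.
case: t IH => [|t] IH.
  apply: (discrete_rv_bind (g := fun k _ => nseq k (1, 0)%N)) => [|k].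
    exact: discrete_rv_nat.
  exact: discrete_rv_cst.
apply: (discrete_rv_bind (g := fun k w => PA (m_at m w) (c_at c w) t.+1 ++
  new_edges (c_at c w) t.+2 k) (f := m t.+2)) => [|k].
  exact: discrete_rv_nat.
exact: discrete_rv_map2 IH (discrete_rv_new_edges _ _).
Qed.

Lemma discrete_rv_PA_step t i : discrete_rv (PAs t i).
Proof. exact: discrete_rv_map2 (discrete_rv_PA _) (discrete_rv_new_edges _ _). Qed.

Definition degrees_upto t w : seq nat := [seq m s w | s <- iota 1 t].

Lemma degrees_uptoP t w w' :
  degrees_upto t w = degrees_upto t w' <->
  forall s, (0 < s <= t)%N -> m s w = m s w'.
Proof.
split=> [/eq_in_map E s st|E].
  by apply: (E s); rewrite mem_iota; lia.
by apply/eq_in_map => s; rewrite mem_iota => st; apply: E; lia.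
Qed.

(** The part of the past that matters up to this edge, coded as a number so that its countably many
    atoms can be treated one by one. *)
Definition history t i w : nat := pickle (degrees_upto t w, PAs t i w).

Lemma discrete_rv_degrees_upto t : discrete_rv (degrees_upto t).
Proof. by apply: discrete_rv_seq => s; exact: discrete_rv_nat. Qed.

Lemma discrete_rv_history t i : discrete_rv (history t i).
Proof.
apply: (discrete_rv_map2 (fun x y => pickle (x, y))).
  exact: discrete_rv_degrees_upto.
exact: discrete_rv_PA_step.
Qed.

Lemma historyP t i w w' : history t i w = history t i w' ->
  (forall s, (0 < s <= t)%N -> m s w = m s w') /\ PAs t i w = PAs t i w'.
Proof.
by move/(pcan_inj pickleK) => [/degrees_uptoP].
Qed.

Lemma past_history t i w : (0 < t)%N ->
  past m c t i (history t i @^-1` [set history t i w]).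
Proof.
(* The atom is an intersection of generators: index 0 fixes the network, indices 1 to t fix the
   initial degrees, and the others impose nothing. *)
move=> t0; pose A s : set Omega :=
  if s == 0%N then [set w' | PAs t i w' = PAs t i w]
  else if (s <= t)%N then [set w' | m s w' = m s w] else setT.
rewrite (_ : _ @^-1` _ = \bigcap_s A s).
  apply: g_sigma_algebra_bigcap => s; rewrite /A.
  case: eqP => [_|/eqP s0]; first by apply: sub_sigma_algebra; right; exists (PAs t i w).
  case: ifP => st; last exact: g_sigma_algebraT.
  by apply: sub_sigma_algebra; left; exists s, (m s w); rewrite lt0n.
apply/seteqP; split=> w' /=.
  move=> /historyP[E1 E2] s _; rewrite /A; case: eqP => // /eqP s0.
  by case: ifP => // st; apply: E1; rewrite lt0n s0.
move=> H; rewrite /history; congr (pickle (_, _)); last exact: (H 0%N I).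
apply/degrees_uptoP => s /andP[s0 st]; have := H s I.
by rewrite /A -[s == 0%N]negbK -lt0n s0 st.
Qed.

(** The defining property of the model for an atom of the history, on which [attach_prob] is
    constant and leaves the integral. *)
Lemma attach_history t i w j : (2 <= t)%N -> (i < m t w)%N -> (j < t)%N ->
  P (history t i @^-1` [set history t i w] `&` c t i.+1 @^-1` [set j]) =
  ((attach_prob (m_at m w) (c_at c w) t i j delta0)%:E *
    P (history t i @^-1` [set history t i w]))%E.
Proof.
move=> t2 im jt; have [_ H] := hPA.
have [_ /(_ j (history t i @^-1` [set history t i w]) jt)] := H t i.+1 t2 isT.
move=> ->.
- rewrite (_ : (\int[P]_(w' in _) _)%E = (\int[P]_(w' in history t i @^-1`
    [set history t i w]) cst (attach_prob (m_at m w) (c_at c w) t i j delta0)%:E w')%E).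
    by rewrite integral_cst //; exact: discrete_rv_history.
  apply: eq_integral => w'; rewrite inE => /historyP[_ E] /=.
  by rewrite /attach_prob /total_weight E.
- by apply: past_history; lia.
- by move=> w' /historyP[E _] /=; rewrite E //; lia.
Qed.

Lemma measurable_edge t i : measurable [set w | (i < m t w)%N].
Proof. exact: (discrete_rv_nat (m t) [set k | (i < k)%N]). Qed.

Lemma measurable_degree t : measurable_fun setT (fun w => (m t w)%:R : R).
Proof.
apply: discrete_rv_measurable => //; apply: discrete_rv_factor (discrete_rv_nat (m t)) _.
by move=> w w' ->.
Qed.

Definition mean_degree : R := fine (\int[P]_w (m 1%N w)%:R%:E)%E.

(** Both integrals are taken against the common law of the initial degrees; the mean is finite
    because k <= k^2. *)
Lemma integral_degree t : (0 < t)%N ->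
  (\int[P]_w (m t w)%:R%:E = mean_degree%:E)%E.
Proof.
move=> t0; have [[_ ident _ m2] _] := hPA.
have natE (X : {RV P >-> nat}) : (\int[P]_w (X w)%:R%:E =
    \int[distribution P X]_(k in setT) (k%:R%:E : \bar R))%E.
  by rewrite (ge0_integral_distribution X (f := fun k => k%:R%:E)).
transitivity (\int[P]_w (m 1%N w)%:R%:E)%E.
  rewrite !natE; apply: eq_measure_integral => A _ _.
  exact: ident.
rewrite /mean_degree fineK // ge0_fin_numE; last first.
  by apply: integral_ge0 => w _; rewrite lee_fin.
apply: le_lt_trans m2; rewrite unlock; apply: ge0_le_integral => //.
- by apply/measurable_EFinP; exact: measurable_degree.
- by apply/measurable_EFinP/measurable_funX; exact: measurable_degree.
- by move=> w _; rewrite lee_fin -natrX ler_nat -{1}(expn1 (m 1%N w)) leq_pexp2l // m_gt0.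
Qed.

Lemma mean_degree_ge0 : 0 <= mean_degree.
Proof.
by rewrite -lee_fin -(@integral_degree 1) // integral_ge0 // => w _; rewrite lee_fin.
Qed.

(** The indicators of l < m_t for l < I add up to min(I, m_t). *)
Lemma sum_tail_le_mean t I : (0 < t)%N ->
  (\sum_(0 <= l < I) P [set w | (l < m t w)%N] <= mean_degree%:E)%E.
Proof.
move=> t0; rewrite -(integral_degree t0).
have PE l : P [set w | (l < m t w)%N] =
    (\int[P]_w (\1_[set w | (l < m t w)%N] w)%:E)%E.
  by rewrite integral_indic ?setIT //; exact: measurable_edge.
rewrite (eq_bigr _ (fun l _ => PE l)).
rewrite -ge0_integral_sum //; last first.
- by move=> l; apply/measurable_EFinP/measurable_indic; exact: measurable_edge.
apply: ge0_le_integral => //.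
- by move=> w _; rewrite sume_ge0.
- apply: emeasurable_sum => l.
  by apply/measurable_EFinP/measurable_indic; exact: measurable_edge.
- by apply/measurable_EFinP; exact: measurable_degree.
move=> w _; rewrite sumEFin lee_fin.
rewrite (eq_bigr (fun l => (l < m t w)%N%:R)); last first.
  move=> l _; rewrite indicE; congr (nat_of_bool _)%:R.
  by apply/idP/idP; rewrite inE.
rewrite -natr_sum ler_nat (_ : (\sum_(0 <= l < I) _)%N = minn I (m t w)) ?geq_minr //.
elim: I => [|I IH]; first by rewrite big_geq // min0n.
by rewrite big_nat_recr //= IH; case: (ltnP I (m t w)) => ?; lia.
Qed.

(** * A law of large numbers for small initial degrees *)

Section small_degrees.
Variable r : nat.

Definition prob_small : R := fine (P [set w | (m 1%N w <= r)%N]).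

Lemma prob_smallE t : (0 < t)%N -> P [set w | (m t w <= r)%N] = prob_small%:E.
Proof.
move=> t0; have [[_ ident _ _] _] := hPA.
have /= -> := ident t [set k | (k <= r)%N] t0.
rewrite fineK //; apply: fin_num_measure.
exact: (discrete_rv_nat (m 1%N) [set k | (k <= r)%N]).
Qed.

Lemma prob_small_itv : 0 <= prob_small <= 1.
Proof.
rewrite -2!lee_fin -(@prob_smallE 1%N) // measure_ge0 probability_le1 //.
exact: (discrete_rv_nat (m 1%N) [set k | (k <= r)%N]).
Qed.

Definition small_deviation n w : R :=
  \sum_(1 <= t < n.+1) ((m t w <= r)%N%:R - prob_small).

Lemma small_deviation_degrees n w w' :
  degrees_upto n w = degrees_upto n w' -> small_deviation n w = small_deviation n w'.
Proof.
move=> /degrees_uptoP E; rewrite /small_deviation !big_nat.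
by apply: eq_bigr => t tn; rewrite E //; lia.
Qed.

Lemma measurable_small_deviation n : measurable_fun setT (small_deviation n).
Proof.
apply: discrete_rv_measurable => //.
apply: discrete_rv_factor (discrete_rv_degrees_upto n) _.
exact: small_deviation_degrees.
Qed.

Lemma small_degrees_upto n w j : (j < 2)%N ->
  P (degrees_upto n @^-1` [set degrees_upto n w] `&`
     (fun w' => (m n.+1 w' <= r)%N : nat) @^-1` [set j]) =
  ((if j == 1%N then prob_small else 1 - prob_small)%:E *
    P (degrees_upto n @^-1` [set degrees_upto n w]))%E.
Proof.
move=> j2; have [[_ _ indep _] _] := hPA.
(* The joint event becomes a product of events on single initial degrees, the last one prescribing
   whether m_{n+1} is at most r. *)
pose A s := if s == n.+1 then [set k : nat | ((k <= r)%N : nat) = j] else [set m s w].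
have iP k s : [set` iota 1 k] s <-> (0 < s <= k)%N.
  by rewrite /mkset mem_iota; split; lia.
have E : degrees_upto n @^-1` [set degrees_upto n w] =
    \bigcap_(t in [set` iota 1 n]) (m t @^-1` A t).
  apply/seteqP; split=> w'.
    by move=> /degrees_uptoP H s /iP sn; rewrite /A ifF /= ?H //; lia.
  move=> H; apply/degrees_uptoP => s sn; have := H s (iffRL (iP n s) sn).
  by rewrite /A ifF //=; lia.
have EA : degrees_upto n @^-1` [set degrees_upto n w] `&`
     (fun w' => (m n.+1 w' <= r)%N : nat) @^-1` [set j] =
    \bigcap_(t in [set` iota 1 n.+1]) (m t @^-1` A t).
  apply/seteqP; split=> w'.
    move=> [/degrees_uptoP H Hj] s /iP sn.
    by rewrite /A; case: eqP => [->//|/eqP sn1]; rewrite /= H //; lia.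
  move=> H; split.
    apply/degrees_uptoP => s sn; have := H s (iffRL (iP n.+1 s) ltac:(lia)).
    by rewrite /A ifF //=; lia.
  have := H n.+1 (iffRL (iP n.+1 n.+1) ltac:(lia)).
  by rewrite /A eqxx.
rewrite EA E !indep ?iota_uniq //; last 2 first.
- by apply/allP => s; rewrite mem_iota; lia.
- by apply/allP => s; rewrite mem_iota; lia.
rewrite -[in iota _ _](addn1 n) iotaD big_cat /= big_seq1 muleC; congr (_ * _)%E.
rewrite add1n /A eqxx.
have mS : measurable [set w | (m n.+1 w <= r)%N].
  exact: (discrete_rv_nat (m n.+1) [set k | (k <= r)%N]).
case: j j2 {A E EA} => [|[|]] // _ /=.
  rewrite (_ : _ @^-1` _ = ~` [set w | (m n.+1 w <= r)%N]).
    by rewrite probability_setC // prob_smallE // EFinB.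
  by apply/seteqP; split=> w' /=; case: leqP.
rewrite -(@prob_smallE n.+1) //; congr (P _).
by apply/seteqP; split=> w' /=; case: leqP.
Qed.

(** Induction with [integral_sqr_centered]: given the first n degrees, the indicator of m_{n+1} <= r
    is a Bernoulli variable with law [q], so each step adds at most 1. *)
Lemma integral_small_deviation n :
  (\int[P]_w (small_deviation n w ^+ 2)%:E <= n%:R%:E)%E.
Proof.
elim: n => [|n IH].
  rewrite integral0_eq // => w _.
  by rewrite /small_deviation big_geq // expr0n.
have /andP[p0 p1] := prob_small_itv.
pose q (_ : Omega) j := if j == 1%N then prob_small else 1 - prob_small.
have qg : \sum_(j < 2) q point j * j%:R = prob_small.
  by rewrite !big_ord_recr big_ord0 /q /=; ring.
rewrite (_ : (\int[P]_w _)%E = (\int[P]_(w in setT) ((small_deviation n w +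
    (((m n.+1 w <= r)%N : nat)%:R - \sum_(j < 2) q w j * j%:R)) ^+ 2)%:E)%E); last first.
  apply: eq_integral => w _.
  rewrite /small_deviation big_nat_recr //=.
  by rewrite -[X in _ = ((_ + (_ - X)) ^+ 2)%:E]/(\sum_(j < 2) q point j * j%:R) qg.
have YE w w' : pickle (degrees_upto n w) = pickle (degrees_upto n w') ->
    degrees_upto n w = degrees_upto n w'.
  exact: (pcan_inj pickleK).
apply: le_trans (@integral_sqr_centered _ _ _ P (fun w => pickle (degrees_upto n w))
  (fun w => (m n.+1 w <= r)%N) setT 2 _ _ _ _ q _ _ _
  (small_deviation n) (fun _ j => j%:R) 1 _ _ _ _) _ => //.
- apply: discrete_rv_factor (discrete_rv_degrees_upto n) _.
  by move=> w w' ->.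
- apply: discrete_rv_factor (discrete_rv_nat (m n.+1)) _.
  by move=> w w' ->.
- by move=> w _; case: (m n.+1 w <= r)%N.
- by move=> w j _ _; rewrite /q; case: eqP => // _; rewrite subr_ge0.
- move=> w j _ j2.
  have YEs : (fun w0 => pickle (degrees_upto n w0)) @^-1`
      [set pickle (degrees_upto n w)] =
      degrees_upto n @^-1` [set degrees_upto n w].
    by apply/seteqP; split=> w' /= => [/YE|->].
  by rewrite YEs; exact: small_degrees_upto.
- by move=> w w' _ /YE; exact: small_deviation_degrees.
- by move=> w [|[|]] // _ _; rewrite ?normr0 ?normr1.
- by move=> w _; rewrite !big_ord_recr big_ord0 /q /=; ring.
rewrite probability_setT expr1n mule1 -natr1 EFinD.
exact: leeD2r.
Qed.

End small_degrees.

Lemma small_degreesE r n w :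
  small_deviation r n w =
  (\sum_(1 <= t < n.+1) (m t w <= r))%:R - prob_small r * n%:R.
Proof.
rewrite /small_deviation sumrB natr_sum; congr (_ - _).
by rewrite sumr_const_nat subSS subn0 mulr_natr.
Qed.

(** By Markov, an integer k above the mean satisfies P(m_1 <= k) > 0; [r] is the least such integer,
    and minimality at r - 1 makes smaller degrees null. *)
Lemma min_degree_exists : exists r, [/\ (0 < r)%N, 0 < prob_small r &
  forall t, (0 < t)%N -> P [set w | (m t w < r)%N] = 0%E].
Proof.
have ex_small : exists r, 0 < prob_small r.
  pose k := (Num.truncn mean_degree).+1; exists k.
  have mk : mean_degree < k%:R by have /andP[] := truncn_itv mean_degree_ge0.
  have mS : measurable [set w | (m 1%N w <= k)%N].
    exact: (discrete_rv_nat (m 1%N) [set l | (l <= k)%N]).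
  have := @markov_ge0 _ _ _ P _ k%:R mean_degree (measurable_degree 1) _ _ _.
  move=> /(_ (fun w => ler0n _ _) ltac:(by rewrite ltr0n))
    /(_ ltac:(by rewrite integral_degree)).
  have PC : P (~` [set w | (m 1%N w <= k)%N]) = (1 - prob_small k)%:E.
    by rewrite probability_setC // prob_smallE // EFinB.
  move=> Pk; have : (P (~` [set w | (m 1%N w <= k)%N]) <= (mean_degree / k%:R)%:E)%E.
    apply: le_trans Pk; apply: le_measure; rewrite ?inE.
    - exact: measurableC.
    - rewrite [X in measurable X](_ : _ = m 1%N @^-1` [set l | (k <= l)%N]).
        exact: discrete_rv_nat.
      by apply/seteqP; split=> w /=; rewrite ler_nat.
    by move=> w /negP; rewrite -ltnNge /= ler_nat => /ltnW.
  rewrite PC lee_fin; have : mean_degree / k%:R < 1 by rewrite ltr_pdivrMr ?mul1r ?ltr0n.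
  lra.
pose r := ex_minn ex_small; exists r.
rewrite /r; case: ex_minnP => {}r r_pos r_min; split=> // [|t t0].
  rewrite lt0n; apply/eqP => r0; move: r_pos; rewrite -lte_fin -(@prob_smallE r 1) //.
  rewrite (_ : [set w | _] = set0) ?measure0 ?ltxx //.
  apply/seteqP; split => // w /=; rewrite r0 leqn0 => /eqP m0.
  by have := @m_gt0 w 1 isT; rewrite /m_at m0.
case: r r_min {r_pos} => [|r] r_min.
  by rewrite (_ : [set w | _] = set0) ?measure0 //; apply/seteqP; split.
rewrite (_ : [set w | _] = [set w | (m t w <= r)%N]) ?prob_smallE //; congr EFin.
have /andP[p0 _] := prob_small_itv r.
apply/eqP; rewrite eq_le p0 andbT leNgt; apply/negP => /r_min.
by rewrite ltnn.
Qed.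

(** * Martingales driven by the edges *)

Section martingale.
Variable f : nat -> network -> nat -> R.

(** The conditional mean, given the past, of [f] at the vertex hit by the edge. *)
Definition compensator t i w : R :=
  \sum_(j < t) attach_prob (m_at m w) (c_at c w) t i j delta0 * f t (PAs t i w) j.

Definition increment t i w : R :=
  f t (PAs t i w) (c t i.+1 w) - compensator t i w.

(* At most [I] edges per vertex are counted, so that every [martingale] is a
   sum with deterministic bounds. *)
Definition martingale I t i w : R :=
  \sum_(2 <= s < t) \sum_(0 <= l < I) (l < m s w)%:R * increment s l w +
  \sum_(0 <= l < i) (l < m t w)%:R * increment t l w.

Lemma compensator_eq t i w w' : PAs t i w = PAs t i w' ->
  compensator t i w = compensator t i w'.
Proof.
by move=> E; rewrite /compensator E /attach_prob /total_weight E.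
Qed.

(** The martingale is adapted: by [PA_step_inj] the history determines every earlier network and
    choice, and edges that do not exist carry the factor 0. *)
Lemma martingale_history I t i w w' : (2 <= t)%N ->
  history t i w = history t i w' -> martingale I t i w = martingale I t i w'.
Proof.
move=> t2 /historyP[Em EG]; have [H1 H2] := PA_step_inj t2 Em EG.
rewrite /martingale /increment; congr (_ + _); rewrite !big_nat.
  apply: eq_bigr => s st; apply: eq_bigr => l _.
  rewrite -Em; last by lia.
  case: ltnP => lm; last by rewrite !mul0r.
  have [E1 E2] := H1 s l st lm.
  by rewrite (compensator_eq E1) E1; move: E2; rewrite /c_at => ->.
apply: eq_bigr => l /andP[_ li]; rewrite -Em; last by lia.
case: ltnP => lm; last by rewrite !mul0r.
have [E1 E2] := H2 l li.
by rewrite (compensator_eq E1) E1; move: E2; rewrite /c_at => ->.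
Qed.

Lemma measurable_martingale I t i : (2 <= t)%N ->
  measurable_fun setT (martingale I t i).
Proof.
move=> t2; apply: discrete_rv_measurable => //.
apply: discrete_rv_factor (discrete_rv_history t i) _ => w w'.
exact: martingale_history.
Qed.

End martingale.

Hypothesis delta0_gt : -1 < delta0.

Lemma attach_prob_ge0 w t i j : (2 <= t)%N -> (j < t)%N ->
  0 <= attach_prob (m_at m w) (c_at c w) t i j delta0.
Proof.
move=> t2 jt; rewrite divr_ge0 ?(ltW (total_weight_gt0 _ _ _ _ _)) //.
- have := degree_step_gt0 (@m_gt0 w) (@c_lt w) i t2 jt.
  by rewrite -(@ler_nat R) => ?; have := delta0_gt; lra.
- exact: m_gt0.
- exact: c_lt.
Qed.

Lemma attach_prob_sum1 w t i : (2 <= t)%N ->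
  \sum_(j < t) attach_prob (m_at m w) (c_at c w) t i j delta0 = 1.
Proof.
move=> t2; apply: (@sum_attach _ t
  (fun v => (degree (PA_step (m_at m w) (c_at c w) t i) v)%:R)) => //.
  exact: ltnW.
move=> v vt; rewrite ler1n.
exact: (degree_step_gt0 (@m_gt0 w) (@c_lt w)).
Qed.

Section martingale_variance.
Variables (f : nat -> network -> nat -> R) (B : R).
Hypothesis fB : forall w t i j, (2 <= t)%N -> (i < m t w)%N -> (j < t)%N ->
  `|f t (PAs t i w) j| <= B.

Let mart_setU I t i k : (2 <= t)%N ->
  (\int[P]_w (martingale f I t i w ^+ 2)%:E =
   \int[P]_(w in [set w | (k < m t w)%N]) (martingale f I t i w ^+ 2)%:E +
   \int[P]_(w in ~` [set w | (k < m t w)%N]) (martingale f I t i w ^+ 2)%:E)%E.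
Proof.
move=> t2; have mD := measurable_edge t k.
rewrite -ge0_integral_setU ?setUv //.
- exact: measurableC.
- apply/measurable_EFinP; apply: measurable_funX.
  exact: measurable_martingale.
- by move=> w _; rewrite lee_fin sqr_ge0.
- by rewrite disj_set2E setICr.
Qed.

(** Where the edge exists, [integral_sqr_centered] applies with the history as conditioning
    variable; elsewhere the martingale does not move. *)
Lemma integral_martingale_step I t i : (2 <= t)%N ->
  (\int[P]_w (martingale f I t i.+1 w ^+ 2)%:E <=
   \int[P]_w (martingale f I t i w ^+ 2)%:E +
   (B ^+ 2)%:E * P [set w | (i < m t w)%N])%E.
Proof.
move=> t2; set D := [set w | _].
have mD : measurable D := measurable_edge t i.
have mS w : martingale f I t i.+1 w =
    martingale f I t i w + (i < m t w)%:R * increment f t i w.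
  by rewrite /martingale big_nat_recr //= addrA.
rewrite !(mart_setU _ _ i) // -/D addeAC leeD //; last first.
  rewrite le_eqVlt; apply/orP; left; apply/eqP; apply: eq_integral => w.
  by rewrite inE /D /= => /negP/negPf im; rewrite mS im mul0r addr0.
have mE w w' : D w -> history t i w = history t i w' ->
    m t w = m t w' /\ PAs t i w = PAs t i w'.
  by move=> Dw /historyP[-> //]; lia.
rewrite (_ : (\int[P]_(w in D) _)%E = (\int[P]_(w in D)
    ((martingale f I t i w + (f t (PAs t i w) (c t i.+1 w) -
     \sum_(j < t) attach_prob (m_at m w) (c_at c w) t i j delta0 *
       f t (PAs t i w) j)) ^+ 2)%:E)%E); last first.
  by apply: eq_integral => w; rewrite inE => Dw; rewrite mS Dw mul1r.
apply: (@integral_sqr_centered _ _ _ P (history t i) (c t i.+1) D t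
  (discrete_rv_history t i) (discrete_rv_nat (c t i.+1)) _ _
  (fun w j => attach_prob (m_at m w) (c_at c w) t i j delta0) _ _ _
  (martingale f I t i) (fun w j => f t (PAs t i w) j)).
- by move=> w w' Yw Dw; have [E _] := mE _ _ Dw Yw; rewrite /D /= -E.
- by move=> w Dw; exact: c_lt.
- move=> w w' Dw Yw; have [_ E] := mE _ _ Dw Yw.
  by apply/funext => j; rewrite /attach_prob /total_weight E.
- by move=> w j _ jt; exact: attach_prob_ge0.
- by move=> w j Dw jt; exact: attach_history.
- by move=> w w' _; exact: martingale_history.
- by move=> w w' Dw Yw; have [_ ->] := mE _ _ Dw Yw.
- by move=> w j Dw jt; exact: fB.
- by move=> w _; exact: attach_prob_sum1.
Qed.

Lemma integral_martingale I t i : (2 <= t)%N ->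
  (\int[P]_w (martingale f I t i w ^+ 2)%:E <=
   (B ^+ 2)%:E * (\sum_(2 <= s < t) \sum_(0 <= l < I) P [set w | (l < m s w)%N] +
     \sum_(0 <= l < i) P [set w | (l < m t w)%N]))%E.
Proof.
move=> t2; have [u ->] : exists u, t = u.+2 by exists t.-2; lia.
elim: u i => [|u IHu] i; elim: i => [|i IHi].
- rewrite integral0_eq; first by rewrite !big_geq // adde0 mule0.
  by move=> w _; rewrite /martingale !big_geq // addr0 expr0n.
- rewrite (le_trans (integral_martingale_step _ _ _)) //.
  rewrite [X in (_ * (_ + X))%E]big_nat_recr //= addeA.
  rewrite ge0_muleDr ?adde_ge0 ?sume_ge0 //; last first.
    by move=> s _; rewrite sume_ge0.
  exact: leeD2r.
(* A new vertex starts from the value reached after all [I] edge slots of the previous one. *)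
- rewrite [X in (_ <= _ * (_ + X))%E]big_geq // adde0.
  rewrite big_nat_recr //=; apply: le_trans (IHu I).
  rewrite le_eqVlt; apply/orP; left; apply/eqP; apply: eq_integral => w _.
  by rewrite /martingale [X in _ + X]big_geq // addr0 big_nat_recr.
- rewrite (le_trans (integral_martingale_step _ _ _)) //.
  rewrite [X in (_ * (_ + X))%E]big_nat_recr //= addeA.
  rewrite ge0_muleDr ?adde_ge0 ?sume_ge0 //; last first.
    by move=> s _; rewrite sume_ge0.
  exact: leeD2r.
Qed.

End martingale_variance.

Lemma integral_martingale_le f (B : R) I n : (0 < n)%N ->
  (forall w t i j, (2 <= t)%N -> (i < m t w)%N -> (j < t)%N ->
    `|f t (PAs t i w) j| <= B) ->
  (\int[P]_w (martingale f I n.+1 0 w ^+ 2)%:E <=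
    (B ^+ 2 * (mean_degree *+ n))%:E)%E.
Proof.
move=> n0 fB; apply: le_trans (@integral_martingale f B fB I n.+1 0%N _) _ => //.
rewrite [X in (_ * (_ + X))%E]big_geq // adde0 [leRHS]EFinM; apply: lee_wpmul2l.
  by rewrite lee_fin sqr_ge0.
apply: (@le_trans _ _ (\sum_(2 <= s < n.+1) mean_degree%:E)%E).
  rewrite !big_nat; apply: lee_sum => s /andP[s2 _].
  by apply: sum_tail_le_mean; exact: ltnW.
rewrite sumEFin lee_fin sumr_const_nat; apply: ler_wpMn2l; [exact: mean_degree_ge0|lia].
Qed.

Lemma martingale_full f I n w :
  (forall t, (2 <= t <= n)%N -> (m t w <= I)%N) ->
  martingale f I n.+1 0 w =
  \sum_(2 <= t < n.+1) \sum_(0 <= i < m t w) increment f t i w.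
Proof.
move=> mI; rewrite /martingale [X in _ + X]big_geq // addr0 !big_nat.
apply: eq_bigr => t tn; have tI := mI t tn.
rewrite (@big_cat_nat _ _ _ (m t w) 0 I) //= [X in _ + X]big_nat.
rewrite [X in _ + X]big1 ?addr0 => [|l /andP[ml _]]; last first.
  by rewrite ltnNge ml mul0r.
by rewrite !big_nat; apply: eq_bigr => l /andP[_ lm]; rewrite lm mul1r.
Qed.

(** * The hit count and the log-likelihood ratio as martingales with drift *)

Definition low_hit r (t : nat) (g : network) (j : nat) : R :=
  (degree g j <= r)%N%:R.

(** At g = PA_{t,i} this is the difference of the logarithms of the attachment probabilities for
    [delta] and [delta0], written as a function of the bare network. *)
Definition log_ratio delta t (g : network) (j : nat) : R :=
  ln (((degree g j)%:R + delta) / \sum_(v < t) ((degree g v)%:R + delta)) -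
  ln (((degree g j)%:R + delta0) / \sum_(v < t) ((degree g v)%:R + delta0)).

Lemma low_hit_le1 r w t i j : `|low_hit r t (PAs t i w) j| <= 1.
Proof. by rewrite normr_nat lern1 leq_b1. Qed.

Lemma log_ratio_le lo b delta w t i j : -1 < lo -> lo <= delta <= b ->
  lo <= delta0 <= b -> (2 <= t)%N -> (j < t)%N ->
  `|log_ratio delta t (PAs t i w) j| <= 2 * (b - lo) / (1 + lo).
Proof.
move=> lo1 /andP[ld db] /andP[ld0 d0b] t2 jt.
apply: le_trans (@dist_ln_attach _ t
  (fun v => (degree (PAs t i w) v)%:R) (ltnW t2) _ lo _ _ j lo1 ld ld0 jt) _.
  move=> v vt; rewrite ler1n.
  exact: (degree_step_gt0 (@m_gt0 w) (@c_lt w)).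
rewrite ler_pM2r ?invr_gt0; last by lra.
by rewrite ler_pM2l // ler_norml; lra.
Qed.

Lemma martingale_low_hit r I n w :
  (forall t, (2 <= t <= n)%N -> (m t w <= I)%N) ->
  martingale (low_hit r) I n.+1 0 w =
  (hit_count (m_at m w) (c_at c w) r n)%:R -
  sum_hit_prob (m_at m w) (c_at c w) delta0 r n.
Proof.
move=> mI; rewrite martingale_full // /hit_count /sum_hit_prob natr_sum -sumrB.
apply: eq_bigr => t _; rewrite natr_sum -sumrB; apply: eq_bigr => i _.
congr (_ - _); rewrite /compensator /hit_prob [RHS]big_mkcond.
by apply: eq_bigr => j _; rewrite /low_hit; case: ifP => _; rewrite ?mulr1 ?mulr0.
Qed.

(** The Doob decomposition of the log-likelihood ratio; the drift is minus a sum of divergences. *)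
Lemma martingale_log_ratio delta I n w :
  (forall t, (2 <= t <= n)%N -> (m t w <= I)%N) ->
  loglik (m_at m w) (c_at c w) n delta - loglik (m_at m w) (c_at c w) n delta0 =
  martingale (log_ratio delta) I n.+1 0 w +
  \sum_(2 <= t < n.+1) \sum_(0 <= i < m_at m w t) \sum_(j < t)
    attach_prob (m_at m w) (c_at c w) t i j delta0 *
    (ln (attach_prob (m_at m w) (c_at c w) t i j delta) -
     ln (attach_prob (m_at m w) (c_at c w) t i j delta0)).
Proof.
move=> mI; rewrite martingale_full // /loglik -sumrB -big_split /=.
apply: eq_bigr => t _; rewrite -sumrB -big_split /=; apply: eq_bigr => i _.
by rewrite /increment subrK.
Qed.

(** The deterministic part of the argument, off the bad events: the hitting probabilities exceed
    rate n, v_2 costs at most half of this, and the martingale at most half of the resulting drift.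
    The cap n^2 on the edges of a vertex is inactive because M_n < n^2. *)
Lemma loglik_gap (delta b e p K : R) r n w : -1 < delta <= b ->
  delta0 <= b -> 0 < e -> e <= `|delta - delta0| -> (0 < r)%N ->
  0 < p <= 1 -> 0 < K -> 16 / p <= n%:R -> (2 <= n)%N ->
  let rate := hit_rate p K delta0 in
  let kappa := (e / (3 * (r%:R + b) * (3 * r%:R + 1 + 3 * b))) ^+ 2 in
  (forall t, (1 <= t <= n)%N -> (r <= m t w)%N) ->
  (\sum_(1 <= t < n.+1) m t w)%:R < K * n%:R ->
  (\sum_(1 <= t < n.+1) m t w < n ^ 2)%N ->
  (m 2 w)%:R < rate / 2 * n%:R ->
  p / 2 * n%:R <= (\sum_(1 <= t < n.+1) (m t w <= r))%:R ->
  `|martingale (low_hit r) (n ^ 2) n.+1 0 w| < p / 8 * n%:R ->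
  `|martingale (log_ratio delta) (n ^ 2) n.+1 0 w| < kappa * rate / 4 * n%:R ->
  loglik (m_at m w) (c_at c w) n delta - loglik (m_at m w) (c_at c w) n delta0 <=
  - (kappa * rate / 4 * n%:R).
Proof.
move=> d1 d0b e0 ed r0 p01 K0 np n2 rate kappa rm mK mn m2 A_ge H1 H2.
have mI t : (2 <= t <= n)%N -> (m t w <= n ^ 2)%N.
  move=> /andP[t2 tn]; apply: ltnW; apply: leq_ltn_trans mn.
  rewrite (@big_cat_nat _ _ _ t 1 n.+1) ?(ltnW t2) ?leqW //=.
  by rewrite (leq_trans _ (leq_addl _ _)) // big_ltn ?ltnS // leq_addr.
have hits : rate * n%:R <= sum_hit_prob (m_at m w) (c_at c w) delta0 r n.
  apply: (sum_hit_prob_ge (@m_gt0 w) (@c_lt w)) => //; first exact: ltW.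
  move: H1; rewrite martingale_low_hit // => /ltW /ler_normlP[_]; lra.
rewrite (martingale_log_ratio _ mI).
have d01 : -1 < delta0 <= b by rewrite delta0_gt.
have D_le := sum_drift_le (@m_gt0 w) (@c_lt w) n2 d1 d01 e0 ed r0 rm.
have k0 : 0 <= kappa by exact: sqr_ge0.
have M_le := le_lt_trans (ler_norm _) H2.
have : kappa * (rate / 2 * n%:R) <=
    kappa * (sum_hit_prob (m_at m w) (c_at c w) delta0 r n - (m 2 w)%:R).
  by rewrite ler_wpM2l //; lra.
by move: D_le; rewrite -/kappa; lra.
Qed.

End random_model.

(** * Union bounds *)

Section union_bound.
Context {d : measure_display} {Omega : measurableType d} {R : realType}.
Variable P : probability Omega R.

(** Measurability travels with the bound, as subadditivity needs it. *)
Definition prob_le (A : set Omega) (v : R) : Prop :=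
  measurable A /\ (P A <= v%:E)%E.

Lemma prob_leU A B u v : prob_le A u -> prob_le B v ->
  prob_le (A `|` B) (u + v).
Proof.
move=> [mA Au] [mB Bv]; split; first exact: measurableU.
by rewrite EFinD (le_trans (measureU2 _ mA mB)) // leeD.
Qed.

Lemma prob_le_ex (A : nat -> set Omega) v N : (forall k, prob_le (A k) v) ->
  prob_le [set w | exists2 k, (k < N)%N & A k w] (v *+ N).
Proof.
move=> Av; elim: N => [|N IH].
  rewrite (_ : [set w | _] = set0); first by split => //; rewrite measure0.
  by apply/seteqP; split => // w [].
rewrite (_ : [set w | _] = [set w | exists2 k, (k < N)%N & A k w] `|` A N).
  by rewrite mulrSr; exact: prob_leU.
apply/seteqP; split=> w /=.
  move=> [k]; rewrite ltnS leq_eqVlt => /predU1P[->|kN] Ak; first by right.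
  by left; exists k.
by move=> [[k kN Ak]|AN]; [exists k => //; exact: ltnW|exists N].
Qed.

Lemma measurable_le_set (F : Omega -> R) (x : R) : measurable_fun setT F ->
  measurable [set w | x <= F w].
Proof.
move=> mF; rewrite (_ : [set w | _] = setT `&` F @^-1` `[x, +oo[).
  by apply: mF => //; exact: measurable_itv.
by rewrite setTI; apply/seteqP; split=> w /=; rewrite in_itv /= andbT.
Qed.

Lemma prob_le_markov (F : Omega -> R) (x V : R) : measurable_fun setT F ->
  (forall w, 0 <= F w) -> 0 < x -> (\int[P]_w (F w)%:E <= V%:E)%E ->
  prob_le [set w | x <= F w] (V / x).
Proof. by move=> mF *; split; [exact: measurable_le_set|exact: markov_ge0]. Qed.

Lemma prob_le_chebyshev (F : Omega -> R) (x V : R) : measurable_fun setT F ->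
  0 < x -> (\int[P]_w (F w ^+ 2)%:E <= V%:E)%E ->
  prob_le [set w | x <= `|F w|] (V / x ^+ 2).
Proof.
move=> mF x0 FV; split; last exact: chebyshev_sqr.
by apply: measurable_le_set; exact: measurableT_comp.
Qed.

End union_bound.

(** * Consistency *)

Section consistency.
Context {d : measure_display} {Omega : measurableType d} {R : realType}.
Variable P : probability Omega R.
Variables (a b delta0 : R).
Hypotheses (ha : -1 < - a) (hdelta0 : - a < delta0 < b).
Variables (m : nat -> {RV P >-> nat}) (c : nat -> nat -> {RV P >-> nat}).
Hypothesis hPA : is_PA m c delta0.

Let delta0_gt : -1 < delta0.
Proof. by case/andP: hdelta0 => + _; exact: lt_trans. Qed.

Let m_gt0 w t : (0 < t)%N -> (0 < m_at m w t)%N.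
Proof. by case: hPA => -[H _ _ _] _; exact: H. Qed.

Let c_lt w t i : (2 <= t)%N -> (i < m_at m w t)%N -> (c_at c w t i.+1 < t)%N.
Proof. by move=> t2 im; case: hPA => _ /(_ t i.+1 t2 isT)[+ _]; exact. Qed.

Lemma measurable_sum_degree n :
  measurable_fun setT (fun w => (\sum_(1 <= t < n.+1) m t w)%:R : R).
Proof.
under eq_fun do rewrite natr_sum.
by apply: measurable_sum => t; exact: measurable_degree.
Qed.

Lemma integral_sum_degree n :
  (\int[P]_w (\sum_(1 <= t < n.+1) m t w)%:R%:E = (mean_degree m * n%:R)%:E)%E.
Proof.
transitivity (\int[P]_w (\sum_(1 <= t < n.+1) (m t w)%:R%:E))%E.
  by apply: eq_integral => w _; rewrite natr_sum sumEFin.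
rewrite ge0_integral_sum //; last first.
  by move=> t; apply/measurable_EFinP; exact: measurable_degree.
rewrite big_nat (eq_bigr (fun=> (mean_degree m)%:E)); last first.
  by move=> t /andP[t1 _]; rewrite (integral_degree hPA).
by rewrite -big_nat sumEFin sumr_const_nat subSS subn0 mulr_natr.
Qed.

Definition grid N k : R := - a + (b + a) * (k%:R / N%:R).

Lemma grid_dense N x : (0 < N)%N -> - a <= x <= b ->
  exists2 k, (k < N.+1)%N & `|x - grid N k| <= (b + a) / N%:R.
Proof.
move=> N0 /andP[ax xb].
have ba : 0 < b + a by case/andP: hdelta0 => ? ?; lra.
have NR : 0 < N%:R :> R by rewrite ltr0n.
have y0 : 0 <= (x + a) / (b + a) * N%:R.
  by rewrite mulr_ge0 // divr_ge0 //; lra.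
(* The grid point just below x is chosen; x = b gives k = N, hence the N + 1 points. *)
have /andP[kle ltk] := truncn_itv y0; set k := Num.truncn _ in kle ltk.
exists k.
  rewrite -(ltr_nat R) -natr1 (le_lt_trans kle) // (@le_lt_trans _ _ N%:R) ?ltrDl //.
  by rewrite ler_piMl ?(ltW NR) // ler_pdivrMr // mul1r; lra.
have -> : x - grid N k = (b + a) / N%:R * ((x + a) / (b + a) * N%:R - k%:R).
  by rewrite /grid; field; rewrite !gt_eqF.
rewrite normrM gtr0_norm ?divr_gt0 // ler_piMr ?(ltW (divr_gt0 _ _)) //.
by rewrite ger0_norm ?subr_ge0 // lerBlDl natr1 ltW.
Qed.

Lemma grid_itv N k : (0 < N)%N -> (k < N.+1)%N -> - a <= grid N k <= b.
Proof.
move=> N0 kN.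
have ba : 0 < b + a by case/andP: hdelta0 => ? ?; lra.
have : 0 <= k%:R / N%:R :> R by [].
have : k%:R / N%:R <= 1 :> R by rewrite ler_pdivrMr ?ltr0n // mul1r ler_nat.
by rewrite /grid; nra.
Qed.

Variable delta_hat : nat -> {RV P >-> R}.
Hypothesis hMLE : forall n, (1 <= n)%N -> is_MLE m c a b n (delta_hat n).

Lemma delta_hat_loglik n w : (0 < n)%N ->
  - a <= delta_hat n w <= b /\
  loglik (m_at m w) (c_at c w) n delta0 <=
  loglik (m_at m w) (c_at c w) n (delta_hat n w).
Proof.
move=> n0; have [+ H] := hMLE n0 w; rewrite /= in_itv /= => D_ab.
split=> //; have /andP[aD Db] := D_ab; have /andP[ad0 d0b] := hdelta0.
have /H : `[- a, b]%classic delta0 by rewrite /= in_itv /= !ltW.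
have ha' := ha; rewrite !(iota_nE (@m_gt0 w) (@c_lt w)) //; last by lra.
by rewrite ler_pM2l // invr_gt0 ltr0n.
Qed.

(** Bounding M_n by K n costs mean / K by Markov, which does not decay with n, so [K] is left free.
    All other bad events have probability O(1 / n). *)
Lemma consistency_bound (eps K : R) : 0 < eps -> 0 < K ->
  exists C n0, forall n, (n0 <= n)%N ->
  (P [set w | (eps <= `|delta_hat n w - delta0|)%R] <=
   (mean_degree m / K + C / n%:R)%:E)%E.
Proof.
move=> eps0 K0; have /andP[ad0 d0b] := hdelta0; have ha' := ha.
have ba : 0 < b + a by lra.
have a1 : 0 < 1 - a by lra.
have [r [r0 p0 Pr]] := min_degree_exists hPA.
set p := prob_small m r in p0.
have p1 : p <= 1 by have /andP[] := prob_small_itv hPA r.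
(* If the estimator is [eps] away from [delta0], a grid point within [step <= e] of it is still at
   distance at least [e]. *)
set e := eps / 2; have e0 : 0 < e by rewrite divr_gt0.
set rate := hit_rate p K delta0.
have rate0 : 0 < rate.
  rewrite lt_min divr_gt0 //= !mulr_gt0 ?divr_gt0 ?invr_gt0 //.
    by have := delta0_gt; lra.
  by rewrite ltr_pwDl ?mulr_gt0.
set kappa := (e / (3 * (r%:R + b) * (3 * r%:R + 1 + 3 * b))) ^+ 2.
have kappa0 : 0 < kappa.
  have r1 : 1 <= r%:R :> R by rewrite ler1n.
  by rewrite exprn_gt0 // divr_gt0 // !mulr_gt0 //; lra.
set theta := kappa * rate / 4; have theta0 : 0 < theta.
  by apply: divr_gt0 => //; exact: mulr_gt0.
(* The second entry keeps the Lipschitz error 2 step / (1 - a) K n below [theta n]. *)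
set step := Num.min e (theta / (4 / (1 - a) * K)).
have step0 : 0 < step.
  by rewrite lt_min e0 /=; apply: divr_gt0 => //; rewrite mulr_gt0 ?divr_gt0.
set N := (Num.truncn ((b + a) / step)).+1.
have N_step : (b + a) / N%:R <= step.
  rewrite ler_pdivrMr ?ltr0n // mulrC -ler_pdivrMr // ltW //.
  by have /andP[] := truncn_itv (ltW (divr_gt0 ba step0)).
set mu := mean_degree m; have mu0 : 0 <= mu := mean_degree_ge0 hPA.
set B := 2 * (b + a) / (1 - a).
exists (mu + mu / (rate / 2) + 4 / p ^+ 2 + mu / (p / 8) ^+ 2 +
  B ^+ 2 * mu / theta ^+ 2 * N.+1%:R).
exists (maxn 2 (Num.truncn (16 / p)).+1) => n; rewrite geq_max => /andP[n2 np].
have {}np : 16 / p <= n%:R.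
  have /andP[_ /ltW h] := truncn_itv (ltW (divr_gt0 (ltr0Sn R 15) p0)).
  by apply: le_trans h _; rewrite ler_nat.
have nR : 0 < n%:R :> R by rewrite ltr0n ltnW.
have n0 : (0 < n)%N by exact: ltnW.
(* A null event. Index 0 is excluded because the model says nothing about [m 0]. *)
have E0 : prob_le P [set w | exists2 s, (s < n.+1)%N & (0 < s)%N /\ (m s w < r)%N] (0 *+ n.+1).
  apply: (@prob_le_ex _ _ _ P (fun s => [set w | (0 < s)%N /\ (m s w < r)%N])) => s.
  have [s0|s0] := posnP s.
    rewrite s0 (_ : [set w | _] = set0); last by apply/seteqP; split => // w [].
    by split => //; rewrite measure0.
  rewrite (_ : [set w | _] = [set w | (m s w < r)%N]); last first.
    by apply/seteqP; split => // w [].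
  split; first exact: (discrete_rv_nat (m s) [set k | (k < r)%N]).
  by rewrite Pr.
have EK : prob_le P [set w | K * n%:R <= (\sum_(1 <= t < n.+1) m t w)%:R] (mu / K).
  rewrite [mu / K](_ : _ = mu * n%:R / (K * n%:R)); last first.
    by field; rewrite !gt_eqF.
  apply: prob_le_markov (measurable_sum_degree n) _ _ _ => //.
    by rewrite mulr_gt0.
  by rewrite integral_sum_degree.
have E1 : prob_le P [set w | (n ^ 2)%:R <= (\sum_(1 <= t < n.+1) m t w)%:R :> R]
    (mu / n%:R).
  rewrite [mu / _](_ : _ = mu * n%:R / (n ^ 2)%:R); last first.
    by rewrite natrX; field; rewrite gt_eqF.
  apply: prob_le_markov (measurable_sum_degree n) _ _ _ => //.
    by rewrite ltr0n expn_gt0 n0.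
  by rewrite integral_sum_degree.
have E2 : prob_le P [set w | rate / 2 * n%:R <= (m 2 w)%:R] (mu / (rate / 2) / n%:R).
  rewrite [_ / n%:R](_ : _ = mu / (rate / 2 * n%:R)); last first.
    by field; rewrite !gt_eqF.
  apply: prob_le_markov (measurable_degree m 2) _ _ _ => //.
    by apply: mulr_gt0 => //; exact: divr_gt0.
  by rewrite (integral_degree hPA).
have E3 : prob_le P [set w | p / 2 * n%:R <= `|small_deviation m r n w|]
    (4 / p ^+ 2 / n%:R).
  rewrite [_ / n%:R](_ : _ = n%:R / (p / 2 * n%:R) ^+ 2); last first.
    by field; rewrite !gt_eqF.
  apply: prob_le_chebyshev (measurable_small_deviation m r n) _ _.
    by apply: mulr_gt0 => //; exact: divr_gt0.
  exact: (integral_small_deviation hPA).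
have E4 : prob_le P [set w | p / 8 * n%:R <=
    `|martingale m c delta0 (low_hit r) (n ^ 2) n.+1 0 w|]
    (mu / (p / 8) ^+ 2 / n%:R).
  rewrite [_ / n%:R](_ : _ = (1 ^+ 2 * (mu *+ n)) / (p / 8 * n%:R) ^+ 2); last first.
    by rewrite -mulr_natr; field; rewrite !gt_eqF.
  apply: prob_le_chebyshev; first exact: measurable_martingale.
    by apply: mulr_gt0 => //; exact: divr_gt0.
  by apply: (integral_martingale_le hPA delta0_gt) => // w t i j _ _ _; exact: low_hit_le1.
(* The interval condition is put inside the event so that one bound holds for every natural k, as
   [prob_le_ex] asks. *)
have E5 : prob_le P [set w | exists2 k, (k < N.+1)%N & (- a <= grid N k <= b) /\
     theta * n%:R <= `|martingale m c delta0 (log_ratio delta0 (grid N k))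
       (n ^ 2) n.+1 0 w|] ((B ^+ 2 * mu / theta ^+ 2 / n%:R) *+ N.+1).
  apply: (@prob_le_ex _ _ _ P (fun k => [set w | (- a <= grid N k <= b) /\
     theta * n%:R <= `|martingale m c delta0 (log_ratio delta0 (grid N k))
       (n ^ 2) n.+1 0 w|])) => k.
  have [kab|kab] := pselect (is_true (- a <= grid N k <= b)); last first.
    rewrite (_ : [set w | _] = set0); last by apply/seteqP; split => // w [].
    split => //; rewrite measure0 lee_fin divr_ge0 // divr_ge0 ?sqr_ge0 //.
    by rewrite mulr_ge0 ?sqr_ge0.
  rewrite (_ : [set w | _] = [set w | theta * n%:R <=
     `|martingale m c delta0 (log_ratio delta0 (grid N k)) (n ^ 2) n.+1 0 w|]); last first.
    by apply/seteqP; split => // w [].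
  rewrite [_ / n%:R](_ : _ = (B ^+ 2 * (mu *+ n)) / (theta * n%:R) ^+ 2); last first.
    by rewrite -mulr_natr; field; rewrite !gt_eqF.
  apply: prob_le_chebyshev; first exact: measurable_martingale.
    by rewrite mulr_gt0.
  apply: (integral_martingale_le hPA delta0_gt) => // w t i j t2 im jt.
  have := @log_ratio_le _ _ _ P m c delta0 hPA (- a) b (grid N k) w t i j ha kab _ t2 jt.
  by rewrite opprK; apply; apply/andP; split; exact: ltW.
have [mU PU] := prob_leU E0 (prob_leU EK (prob_leU E1 (prob_leU E2
  (prob_leU E3 (prob_leU E4 E5))))).
apply: le_trans (le_trans _ PU) _; last first.
  rewrite lee_fin mul0rn add0r -[_ *+ N.+1]mulr_natr.
  by rewrite le_eqVlt; apply/orP; left; apply/eqP; move: (N.+1%:R) => ?; ring.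
apply: le_measure; rewrite ?inE //.
  apply: measurable_le_set; apply: measurableT_comp => //.
  by apply: measurable_funB.
(* Outside the seven bad events an estimator far from [delta0] leads to a contradiction. *)
move=> w /= D_eps; apply: contrapT.
move=> /not_orP[n_r /not_orP[/negP + /not_orP[/negP + /not_orP[/negP +
  /not_orP[/negP + /not_orP[/negP + n_5]]]]]].
rewrite -!ltNge ltr_nat => n_K n_1 n_2 n_3 n_4.
have [D_ab D_lik] := delta_hat_loglik w n0.
have N0 : (0 < N)%N by [].
have [k kN Dk] := grid_dense N0 D_ab.
have k_ab := grid_itv N0 kN; have /andP[ak kb] := k_ab.
have {}Dk : `|delta_hat n w - grid N k| <= step by exact: le_trans Dk N_step.
have ek : e <= `|grid N k - delta0|.
  have : step <= e by rewrite ge_min lexx.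
  have := ler_distD (grid N k) (delta_hat n w) delta0.
  by rewrite /e in Dk *; lra.
have n_rk t : (1 <= t <= n)%N -> (r <= m t w)%N.
  move=> /andP[t1 tn]; rewrite leqNgt; apply/negP => mr; apply: n_r.
  by exists t.
have n_k : `|martingale m c delta0 (log_ratio delta0 (grid N k)) (n ^ 2) n.+1 0 w|
    < theta * n%:R.
  by rewrite ltNge; apply/negP => Hk; apply: n_5; exists k.
have A_ge : p / 2 * n%:R <= (\sum_(1 <= t < n.+1) (m t w <= r))%:R.
  move: n_3; rewrite small_degreesE -/p => /ltW /ler_normlP[+ _].
  lra.
have d1 : -1 < grid N k <= b by rewrite kb andbT (lt_le_trans ha').
have p01 : 0 < p <= 1 by rewrite p0.
have gap := loglik_gap hPA delta0_gt d1 (ltW d0b) e0 ek r0 p01 K0 np n2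
  n_rk n_K n_1 n_2 A_ge n_4 n_k.
have /andP[aD _] := D_ab.
have lip := loglik_lipschitz (@m_gt0 w) (@c_lt w) n ha' aD ak.
have lip_le : 2 * `|delta_hat n w - grid N k| / (1 + - a) *
    (\sum_(1 <= t < n.+1) m t w)%:R < theta * n%:R.
  apply: (@le_lt_trans _ _ (2 * step / (1 - a) * (\sum_(1 <= t < n.+1) m t w)%:R)).
    by rewrite ler_wpM2r // ler_pM2r ?invr_gt0 // ler_pM2l.
  apply: (@lt_le_trans _ _ (2 * step / (1 - a) * (K * n%:R))).
    by rewrite ltr_pM2l //; apply: divr_gt0 => //; exact: mulr_gt0.
  have : step <= theta / (4 / (1 - a) * K) by rewrite ge_min lexx orbT.
  rewrite ler_pdivlMr; last by apply: mulr_gt0 => //; exact: divr_gt0.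
  move=> step_le.
  rewrite (_ : _ * (K * n%:R) = step * (4 / (1 - a) * K) / 2 * n%:R); last first.
    by field; rewrite gt_eqF.
  by rewrite ler_pM2r //; lra.
(* The grid point lies at least [theta n] below [delta0] in log-likelihood, and the estimator gains
   less than [theta n] on it, so it cannot reach the value at [delta0]. *)
have := le_lt_trans (ler_norm _) (le_lt_trans lip lip_le).
move: gap; rewrite -/rate -/kappa -/theta; lra.
Qed.

End consistency.

Theorem theorem1 (R : realType) (d : measure_display)
    (Omega : measurableType d) (P : probability Omega R)
    (a b : R) (ha : -1 < - a) (hab : - a < b)
    (delta0 : R) (hdelta0 : - a < delta0 < b)
    (m : nat -> {RV P >-> nat}) (c : nat -> nat -> {RV P >-> nat})
    (hPA : is_PA m c delta0)
    (delta_hat : nat -> {RV P >-> R})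
    (hMLE : forall n, (1 <= n)%N -> is_MLE m c a b n (delta_hat n)) :
  cvg_in_probability delta_hat delta0.
Proof.
move=> eps eps0; apply/fine_cvgP; split.
  apply: nearW => n; apply: fin_num_measure; apply: measurable_le_set.
  by apply: measurableT_comp => //; exact: measurable_funB.
apply/cvgrPdist_le => /= eta eta0.
set mu := mean_degree m; have mu0 : 0 <= mu := mean_degree_ge0 hPA.
(* This makes [mu / K] at most [eta / 2]; the 1 keeps [K] positive knowing only [0 <= mu]. Large n
   takes care of the other half. *)
set K := (2 * mu + 1) / eta.
have K0 : 0 < K by rewrite divr_gt0 //; lra.
have [C [n0 H]] := consistency_bound ha hdelta0 hPA hMLE eps0 K0.
exists (maxn n0 (Num.truncn (2 * `|C| / eta)).+1) => // n /=.
rewrite geq_max => /andP[n0n nC].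
have mE : measurable [set w | eps <= `|delta_hat n w - delta0|].
  by apply: measurable_le_set; apply: measurableT_comp => //; exact: measurable_funB.
rewrite sub0r normrN ger0_norm ?fine_ge0 ?measure_ge0 //.
rewrite -lee_fin fineK; last exact: fin_num_measure.
apply: le_trans (H n n0n) _; rewrite lee_fin.
have nR : 0 < n%:R :> R by rewrite ltr0n; exact: leq_trans nC.
have muK : mu / K <= eta / 2.
  have KE : K * eta = 2 * mu + 1 by rewrite divfK ?gt_eqF.
  by rewrite ler_pdivrMr //; lra.
have Cn : C / n%:R <= eta / 2.
  rewrite ler_pdivrMr //.
  have nC' : 2 * `|C| / eta <= n%:R.
    have h0 : 0 <= 2 * `|C| / eta by rewrite divr_ge0 ?mulr_ge0 // ltW.
    have /andP[_ /ltW h] := truncn_itv h0.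
    by apply: le_trans h _; rewrite ler_nat.
  move: nC'; rewrite ler_pdivrMr // => nC'.
  have := ler_norm C; lra.
by rewrite -/mu; lra.
Qed.
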